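(* Let $r\ge 4$ and let $M\subseteq E(K_r)$ be a nonempty set of edges of the complete graph $K_r$. (i) If $M$ is a matching, then there exists $N$ such that every $(K_r-M)$-minor free graph $G$ on $n\ge N$ vertices satisfies $\lambda(G)\le\lambda(F_{n,r-3})$, with equality if and only if $G= F_{n,r-3}$. (ii) If $M$ is not a matching and the graph formed by the edges of $M$ is connected and contains no triangle $K_3$, then there exists $N$ such that every $(K_r-M)$-minor free graph $G$ on $n\ge N$ vertices satisfies $\lambda(G)\le\lambda(S_{n,r-3})$, with equality if and only if $G= S_{n,r-3}$.
   Context: All graphs are finite and simple. $\lambda(G)$ denotes the spectral radius of the adjacency matrix of $G$. $K_r-M$ is $K_r$ with the edges of $M$ deleted. A graph $H$ is a minor of $G$ if $H$ can be obtained from $G$ by vertex deletions, edge deletions and edge contractions; $G$ is $H$-minor free if it has no $H$ minor. $G\nabla H$ is the join, $\cup$ disjoint union, $pK_2$ is $p$ disjoint edges. $S_{n,t}=K_t\nabla\overline{K}_{n-t}$. $F_{n,t}=K_t\nabla(pK_2\cup K_q)$ where $n-t=2p+q$ and $q\in\{0,1\}$. *)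

(* Defs.v *)
From HB Require Import structures.
From mathcomp Require Import all_boot all_order all_algebra all_field.

Set Implicit Arguments.
Unset Strict Implicit.
Unset Printing Implicit Defensive.

Import Order.TTheory GRing.Theory Num.Theory.

(** * Finite simple graphs *)

Record sgraph := SGraph {
  vertex :> finType;
  adj : rel vertex;
  adj_sym : symmetric adj;
  adj_irr : irreflexive adj }.

Arguments adj : clear implicits.

Definition isomorphic (G H : sgraph) : Prop :=
  exists f : G -> H, bijective f /\ {mono f : x y / adj G x y >-> adj H x y}.

(* An edge is the 2-element set of its endpoints. *)
Definition edges (G : sgraph) : {set {set G}} :=
  [set [set p.1; p.2] | p : G * G & adj G p.1 p.2].

Definition gconnected (G : sgraph) : Prop :=
  forall x y : G, connect (adj G) x y.

Definition triangle_free (G : sgraph) : Prop :=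
  ~ exists x y z : G, [/\ adj G x y, adj G y z & adj G x z].

(** * Constructions *)

Section Complete.
Variable n : nat.
Definition complete_rel : rel 'I_n := fun x y => x != y.
Lemma complete_sym : symmetric complete_rel.
Proof. by move=> x y; rewrite /complete_rel eq_sym. Qed.
Lemma complete_irr : irreflexive complete_rel.
Proof. by move=> x; rewrite /complete_rel eqxx. Qed.
Definition complete := SGraph complete_sym complete_irr.
End Complete.

Section Complement.
Variable G : sgraph.
Definition gcompl_rel : rel G := fun x y => (x != y) && ~~ adj G x y.
Lemma gcompl_sym : symmetric gcompl_rel.
Proof. by move=> x y; rewrite /gcompl_rel eq_sym adj_sym. Qed.
Lemma gcompl_irr : irreflexive gcompl_rel.
Proof. by move=> x; rewrite /gcompl_rel eqxx. Qed.
Definition gcompl := SGraph gcompl_sym gcompl_irr.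
End Complement.

Section DisjointUnion.
Variables G H : sgraph.
Definition gunion_rel : rel (G + H)%type := fun u v =>
  match u, v with
  | inl x, inl y => adj G x y
  | inr x, inr y => adj H x y
  | _, _ => false
  end.
Lemma gunion_sym : symmetric gunion_rel.
Proof. by move=> [x|x] [y|y] //=; apply: adj_sym. Qed.
Lemma gunion_irr : irreflexive gunion_rel.
Proof. by move=> [x|x] /=; apply: adj_irr. Qed.
Definition gunion := SGraph gunion_sym gunion_irr.
End DisjointUnion.

Section Join.
Variables G H : sgraph.
Definition gjoin_rel : rel (G + H)%type := fun u v =>
  match u, v with
  | inl x, inl y => adj G x y
  | inr x, inr y => adj H x y
  | _, _ => true
  end.
Lemma gjoin_sym : symmetric gjoin_rel.
Proof. by move=> [x|x] [y|y] //=; apply: adj_sym. Qed.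
Lemma gjoin_irr : irreflexive gjoin_rel.
Proof. by move=> [x|x] /=; apply: adj_irr. Qed.
Definition gjoin := SGraph gjoin_sym gjoin_irr.
End Join.

(* [copies p G] is the disjoint union of [p] copies of [G]. *)
Section Copies.
Variables (p : nat) (G : sgraph).
Definition copies_rel : rel ('I_p * G)%type :=
  fun u v => (u.1 == v.1) && adj G u.2 v.2.
Lemma copies_sym : symmetric copies_rel.
Proof. by move=> u v; rewrite /copies_rel eq_sym adj_sym. Qed.
Lemma copies_irr : irreflexive copies_rel.
Proof. by move=> u; rewrite /copies_rel adj_irr andbF. Qed.
Definition copies := SGraph copies_sym copies_irr.
End Copies.

(* Both graphs have [n] vertices only when [t <= n]. *)
Definition S_graph (n t : nat) : sgraph :=
  gjoin (complete t) (gcompl (complete (n - t))).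

Definition F_graph (n t : nat) : sgraph :=
  gjoin (complete t)
        (gunion (copies (n - t)./2 (complete 2)) (complete (odd (n - t)))).

(** * Edge sets *)

Section EdgeDeletion.
Variables (G : sgraph) (M : {set {set G}}).
Definition del_edges_rel : rel G :=
  fun x y => adj G x y && ([set x; y] \notin M).
Lemma del_edges_sym : symmetric del_edges_rel.
Proof. by move=> x y; rewrite /del_edges_rel adj_sym setUC. Qed.
Lemma del_edges_irr : irreflexive del_edges_rel.
Proof. by move=> x; rewrite /del_edges_rel adj_irr. Qed.
Definition del_edges := SGraph del_edges_sym del_edges_irr.
End EdgeDeletion.

(* Distinct edges in a matching have no common endpoint. *)
Definition matching (T : finType) (M : {set {set T}}) : Prop := trivIset M.

(* The graph formed by the edges in [M]: its vertices are the endpoints of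
   those edges, so it has no isolated vertex. *)
Section EdgeInduced.
Variables (T : finType) (M : {set {set T}}).
Definition edge_graph_rel : rel {x : T | x \in cover M} :=
  fun x y => (x != y) && ([set val x; val y] \in M).
Lemma edge_graph_sym : symmetric edge_graph_rel.
Proof. by move=> x y; rewrite /edge_graph_rel eq_sym setUC. Qed.
Lemma edge_graph_irr : irreflexive edge_graph_rel.
Proof. by move=> x; rewrite /edge_graph_rel eqxx. Qed.
Definition edge_graph := SGraph edge_graph_sym edge_graph_irr.
End EdgeInduced.

(** * Minors *)

Section VertexDeletion.
Variables (G : sgraph) (v : G).
Definition del_vertex_rel : rel {x : G | x != v} :=
  fun x y => adj G (val x) (val y).
Lemma del_vertex_sym : symmetric del_vertex_rel.
Proof. by move=> x y; apply: adj_sym. Qed.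
Lemma del_vertex_irr : irreflexive del_vertex_rel.
Proof. by move=> x; apply: adj_irr. Qed.
Definition del_vertex := SGraph del_vertex_sym del_vertex_irr.
End VertexDeletion.

(* Contraction of [uv]: [v] is removed and [u] inherits its neighbours. *)
Section Contraction.
Variables (G : sgraph) (u v : G).
Definition contract_rel : rel {x : G | x != v} := fun x y =>
  (x != y) &&
  [|| adj G (val x) (val y),
      (val x == u) && adj G v (val y) |
      (val y == u) && adj G v (val x)].
Lemma contract_sym : symmetric contract_rel.
Proof.
by move=> x y; rewrite /contract_rel eq_sym adj_sym; congr (_ && (_ || _)); rewrite orbC.
Qed.
Lemma contract_irr : irreflexive contract_rel.
Proof. by move=> x; rewrite /contract_rel eqxx. Qed.
Definition contract := SGraph contract_sym contract_irr.
End Contraction.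

Inductive is_minor (H : sgraph) : sgraph -> Prop :=
| minor_iso (G : sgraph) :
    isomorphic G H -> is_minor H G
| minor_del_vertex (G : sgraph) (v : G) :
    is_minor H (del_vertex v) -> is_minor H G
| minor_del_edge (G : sgraph) (u v : G) :
    adj G u v -> is_minor H (del_edges [set [set u; v]]) -> is_minor H G
| minor_contract (G : sgraph) (u v : G) :
    adj G u v -> is_minor H (contract u v) -> is_minor H G.

Definition minor_free (H G : sgraph) : Prop := ~ is_minor H G.

(** * Spectral radius *)

Local Open Scope ring_scope.

Definition adjacency_mx (G : sgraph) : 'M[algC]_#|G| :=
  \matrix_(i, j) (adj G (enum_val i) (enum_val j))%:R.

(* [algC] contains every eigenvalue of an integer matrix, and its order is
   total on real elements, in particular on moduli. *)
Definition spectral_radius n (A : 'M[algC]_n) : algC :=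
  \big[Num.max/0]_(z <- sval (closed_field_poly_normal (char_poly A))) `|z|.

Definition lambda (G : sgraph) : algC := spectral_radius (adjacency_mx G).

(* Main.v *)
(* Let t = r - 3.  An edge of M, or two edges of M with a common end, shows that
   K_r - M is a minor of K_t joined to a path with two edges, respectively to an
   edge and an isolated vertex, and of the complete bipartite graph K_{t+1,r}.
   So in a (K_r - M)-minor free graph G any t + 1 vertices have fewer than r
   common neighbours, and e(W) = O(|W|) for every vertex set W by Mader's theorem.
   Let x be a Perron vector of G with maximum 1.  As lambda(F)^2 >= t(n - t) for the
   extremal graph F, one may assume lambda(G)^2 >= t(n - t).  Then counting walks
   of length two from the vertices with large entries yields a set T of t vertices
   of degree (1 - o(1))n with entries 1 - o(1), all other entries
   being o(1).  Let B be the common neighbourhood of T; then G[B] is a matching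
   in (i) and has no edge in (ii).  Place a copy of F on the
   vertices of G, with T as its dominating clique and containing G[B].  Going from
   G to F, each vertex v outside of T and B loses at most x_v o(1) in the
   quadratic form of x, because of the sparsity of G, and gains at least about
   x_v for a missing edge to T.  Hence lambda(G) <= lambda(F), with equality only
   if x is a Perron vector of F, thus positive, and G = F. *)
Require Import Defs.
From mathcomp Require Import all_boot all_order all_algebra all_field.
From mathcomp Require Import spectral sesquilinear zify ring lra.
Set Implicit Arguments.
Unset Strict Implicit.
Unset Printing Implicit Defensive.
Import Order.TTheory GRing.Theory Num.Theory.

(** * Minor models *)

Section Connected.
Variable G : sgraph.
Implicit Types A B S : {set G}.

(* Every set closed under adjacency inside [A] that meets [A] contains [A]; the
   empty set is connected in this sense. *)
Definition conn A := [forall S : {set G},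
  (A :&: S != set0) ==>
  [forall x in A :&: S, forall y in A, adj G x y ==> (y \in S)] ==>
  (A \subset S)].

Lemma connP A : reflect (forall S x, x \in A -> x \in S ->
    (forall a b, a \in A -> a \in S -> b \in A -> adj G a b -> b \in S) ->
    A \subset S) (conn A).
Proof.
apply: (iffP forallP) => [h S x xA xS cl|h S].
  have := h S; have -> : A :&: S != set0 by apply/set0Pn; exists x; rewrite inE xA.
  move=> /implyP /(_ isT) /implyP; apply; apply/forall_inP => a /setIP[aA aS].
  by apply/forall_inP => b bA; apply/implyP => ab; apply: cl ab.
apply/implyP => /set0Pn [x /setIP[xA xS]]; apply/implyP => /forall_inP cl.
apply: (h S x) => // a b aA aS bA ab.
have aAS : a \in A :&: S by rewrite inE aA.
by have /forall_inP/(_ b bA)/implyP/(_ ab) := cl a aAS.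
Qed.

Lemma conn1 x : conn [set x].
Proof. by apply/connP => S y /set1P -> xS _; rewrite sub1set. Qed.

Definition touch A B := [exists x in A, exists y in B, adj G x y].

Lemma touchP A B :
  reflect (exists x y, [/\ x \in A, y \in B & adj G x y]) (touch A B).
Proof.
apply: (iffP exists_inP) => [[x xA /exists_inP[y yB xy]]|[x [y [xA yB xy]]]].
  by exists x, y.
by exists x => //; apply/exists_inP; exists y.
Qed.

Lemma touch_sym A B : touch A B = touch B A.
Proof.
by apply/touchP/touchP => -[x [y [xA yB xy]]]; exists y, x; split; rewrite // adj_sym.
Qed.

Lemma connU A B : conn A -> conn B -> touch A B -> conn (A :|: B).
Proof.
move=> /connP cA /connP cB /touchP [a [b [aA bB ab]]].
apply/connP => S x xAB xS cl.
have clA S' x' : x' \in A -> x' \in S -> A \subset S.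
  by move=> x'A x'S; apply: (cA S x') => // c d cA' cS dA; apply: cl => //; rewrite inE ?cA' ?dA.
have clB S' x' : x' \in B -> x' \in S -> B \subset S.
  by move=> x'B x'S; apply: (cB S x') => // c d cB' cS dB; apply: cl => //; rewrite inE ?cB' ?dB orbT.
have [AS BS] : A \subset S /\ B \subset S.
  case/setUP: xAB => [xA|xB].
    have AS := clA S x xA xS; split=> //; apply: (clB S b) => //.
    by apply: cl ab; rewrite ?inE ?aA ?bB ?orbT // (subsetP AS).
  have BS := clB S x xB xS; split=> //; apply: (clA S a) => //.
  by apply: (cl b a); rewrite ?inE ?aA ?bB ?orbT // ?(subsetP BS) // adj_sym.
by rewrite subUset AS.
Qed.

(** If [x] had no neighbour in the rest of [A], the set [[set x]] would be closed and contain [A].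
    The edge found here is the one to contract in a branch set. *)
Lemma conn_edge A x : conn A -> x \in A -> A != [set x] ->
  exists2 y, y \in A :\ x & adj G x y.
Proof.
move=> /connP cA xA Ax.
case: (boolP [exists y in A :\ x, adj G x y]) => [/exists_inP//|/exists_inPn no].
case/negP: Ax; rewrite eqEsubset sub1set xA andbT.
apply: (cA _ x) => // [|a b aA /set1P -> bA xb]; first by rewrite inE.
case: (b =P x) => [->|/eqP bx]; first by rewrite inE.
by have := no b; rewrite !inE bx bA xb => /(_ isT).
Qed.

Lemma conn2 x y : adj G x y -> conn [set x; y].
Proof.
by move=> xy; apply: connU (conn1 x) (conn1 y) _; apply/touchP; exists x, y; rewrite !inE !eqxx.
Qed.

End Connected.

(** Branch-set form of the minor relation. Minors are constructed in this form and turned into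
    deletions and contractions by [model_is_minor]. *)
Definition model (H G : sgraph) : Prop := exists phi : H -> {set G},
  [/\ forall h, phi h != set0, forall h, conn (phi h),
      forall h k, h != k -> [disjoint phi h & phi k] &
      forall h k, adj H h k -> touch (phi h) (phi k)].

Lemma model_sub (H H' G : sgraph) (f : H' -> H) : injective f ->
  (forall h k, adj H' h k -> adj H (f h) (f k)) -> model H G -> model H' G.
Proof.
move=> fi fa [phi [p0 pc pd pt]]; exists (phi \o f); split=> //= h k.
  by rewrite -(inj_eq fi) => /pd.
by move=> /fa /pt.
Qed.

Section ModelMinor.
Variable H : sgraph.

(** Induction on the number of edges of [G]: an edge that does not come from [H] is deleted, and
    when none is left [f] is an isomorphism. *)
Lemma spanning_is_minor (G : sgraph) (f : H -> G) : bijective f ->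
  (forall h k, adj H h k -> adj G (f h) (f k)) -> is_minor H G.
Proof.
have [m] := ubnP #|[set p : G * G | adj G p.1 p.2]|.
elim: m G f => // m IH G f; rewrite ltnS => le_m fb fa.
have [f' fK f'K] := fb.
case: (boolP [forall p : H * H, adj G (f p.1) (f p.2) ==> adj H p.1 p.2]).
  move=> /forallP all_eq; apply: minor_iso; exists f'; split.
    by exists f.
  move=> x y; rewrite -{2}(f'K x) -{2}(f'K y); apply/idP/idP; first exact: fa.
  exact: (implyP (all_eq (f' x, f' y))).
rewrite negb_forall => /existsP [[h k]] /=; rewrite negb_imply => /andP[ghk nhk].
apply: (minor_del_edge ghk); apply: (IH (del_edges [set [set f h; f k]]) f) => //.
  apply: leq_trans le_m; apply: proper_card; apply/properP; split.
    by apply/subsetP => p; rewrite !inE /= => /andP[].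
  by exists (f h, f k); rewrite !inE //= /del_edges_rel ghk inE eqxx.
move=> a b ab; rewrite /= /del_edges_rel fa // inE /=.
apply/negP => /eqP /setP e; case/negP: nhk.
have fi := can_inj fK.
have : (f h \in [set f a; f b]) && (f k \in [set f a; f b]).
  by rewrite !e !inE !eqxx orbT.
rewrite !inE !(inj_eq fi) => /andP[/orP[]/eqP hE /orP[]/eqP kE];
  by move: ghk; rewrite hE kE ?adj_irr // => _; rewrite adj_sym.
Qed.

Lemma model_del_vertex (G : sgraph) (v : G) (phi : H -> {set G}) :
  [/\ forall h, phi h != set0, forall h, conn (phi h),
      forall h k, h != k -> [disjoint phi h & phi k] &
      forall h k, adj H h k -> touch (phi h) (phi k)] ->
  (forall h, v \notin phi h) -> model H (del_vertex v).
Proof.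
move=> [p0 pc pd pt] vn.
have nv h x : x \in phi h -> x != v by apply: contraTneq => ->.
exists (fun h => [set x : del_vertex v | val x \in phi h]); split.
- move=> h; have /set0Pn [x xh] := p0 h; apply/set0Pn; exists (Sub x (nv _ _ xh)).
  by rewrite inE.
- move=> h; apply/connP => S x; rewrite inE => xh xS cl.
  apply/subsetP => y; rewrite inE => yh.
  have /subsetP : phi h \subset [set val z | z in S].
    have /connP := pc h; apply; first exact: xh.
      by apply/imsetP; exists x.
    move=> a b ah /imsetP [a' a'S ea] bh ab; apply/imsetP.
    exists (Sub b (nv _ _ bh)) => //; apply: (cl a'); rewrite ?inE /= ?SubK -?ea //.
    by rewrite /del_vertex_rel SubK -ea.
  by move=> /(_ _ yh) /imsetP [z zS /val_inj ->].
- move=> h k /pd /pred0P dhk; apply/pred0P => x /=; rewrite !inE.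
  exact: dhk (val x).
move=> h k /pt /touchP [x [y [xh yk xy]]]; apply/touchP.
by exists (Sub x (nv _ _ xh)), (Sub y (nv _ _ yk)); rewrite !inE.
Qed.

Lemma model_contract (G : sgraph) (u v : G) (h0 : H) (phi : H -> {set G}) :
  [/\ forall h, phi h != set0, forall h, conn (phi h),
      forall h k, h != k -> [disjoint phi h & phi k] &
      forall h k, adj H h k -> touch (phi h) (phi k)] ->
  u \in phi h0 -> v \in phi h0 -> u != v -> model H (contract u v).
Proof.
move=> [p0 pc pd pt] uh vh uv.
pose u' : contract u v := Sub u uv.
(* The default value of [insubd] is taken only at [v], so [f] is the contraction map: [v] goes to
   [u] and all else is fixed. *)
pose f x : contract u v := insubd u' x.
have fE x : x != v -> val (f x) = x by move=> xv; rewrite val_insubd xv.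
have fv : f v = u' by apply: val_inj; rewrite val_insubd eqxx.
have fK (x : contract u v) : f (val x) = x by apply: val_inj; rewrite fE // (valP x).
have uphi h : v \in phi h -> u \in phi h.
  move=> vh'; case: (h =P h0) => [->//|/eqP /pd /pred0P /(_ v) /=].
  by rewrite vh vh'.
have fin h x : x \in phi h -> val (f x) \in phi h.
  by case: (x =P v) => [->|/eqP xv]; [rewrite fv; exact: uphi|rewrite fE].
have fadj x y : adj G x y -> f x != f y -> adj (contract u v) (f x) (f y).
  move=> xy nxy; rewrite /= /contract_rel nxy /=.
  case: (x =P v) xy => [->|/eqP xv] xy.
    have yv : y != v by apply: contraTneq xy => ->; rewrite adj_irr.
    by rewrite fv /= fE // eqxx xy orbT.
  rewrite (fE x) //; case: (y =P v) xy => [->|/eqP yv] xy.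
    by rewrite fv /= eqxx [adj G v x]adj_sym xy !orbT.
  by rewrite fE // xy.
exists (fun h => [set x : contract u v | val x \in phi h]); split.
- move=> h; have /set0Pn [x xh] := p0 h; apply/set0Pn; exists (f x).
  by rewrite inE fin.
- move=> h; apply/connP => S x; rewrite inE => xh xS cl.
  apply/subsetP => y; rewrite inE => yh.
  have /subsetP : phi h \subset [set z | f z \in S].
    have /connP := pc h; apply; first exact: xh.
      by rewrite inE fK.
    move=> a b ah; rewrite !inE => aS bh ab.
    case: (f a =P f b) => [<-//|/eqP nab].
    by apply: (cl (f a)); rewrite ?inE ?fin //; exact: fadj.
  by move=> /(_ _ yh); rewrite inE fK.
- move=> h k /pd /pred0P dhk; apply/pred0P => x /=; rewrite !inE.
  exact: dhk (val x).
move=> h k hk; have /touchP [x [y [xh yk xy]]] := pt h k hk; apply/touchP.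
exists (f x), (f y); rewrite !inE !fin //; split=> //; apply: fadj => //.
(* Equal images would be a common vertex of the branch sets of [h] and [k], forcing [h = k]. *)
apply: contraTneq hk => exy.
case: (h =P k) => [->|/eqP /pd /pred0P /(_ (val (f x))) /=]; first by rewrite adj_irr.
by rewrite fin // exy fin.
Qed.

(** Induction on the order of [G]: a vertex in no branch set is deleted; an edge inside a branch set
    with two or more vertices is contracted; otherwise the branch sets are singletons covering [G]
    and only surplus edges remain. *)
Theorem model_is_minor (G : sgraph) : model H G -> is_minor H G.
Proof.
have [m] := ubnP #|G|; elim: m G => // m IH G; rewrite ltnS => le_m [phi pP].
have smaller (v : G) : (#|{: {x : G | x != v}}| < m)%N.
  by rewrite card_sig (cardD1 v) inE /= in le_m *; apply: leq_trans le_m; rewrite add1n ltnS;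
     apply: subset_leq_card; apply/subsetP => x; rewrite !inE andbT.
case: (boolP [forall v : G, exists h, v \in phi h]); last first.
  rewrite negb_forall => /existsP [v]; rewrite negb_exists => /forallP vn.
  by apply: (@minor_del_vertex _ _ v); apply: (IH (del_vertex v) (smaller v)); exact: model_del_vertex pP vn.
move=> /forallP cov.
case: (boolP [exists h, 1 < #|phi h|]) => [/existsP [h lh]|].
  have [p0 pc pd pt] := pP; have /set0Pn [u uh] := p0 h.
  have [|v] := conn_edge (pc h) uh.
    by apply: contraTneq lh => ->; rewrite cards1.
  rewrite !inE => /andP[vu vh] uv; apply: (minor_contract uv).
  apply: (IH (contract u v) (smaller v)); apply: (model_contract pP uh vh).
  by rewrite eq_sym.
rewrite negb_exists => /forallP l1.
have [p0 pc pd pt] := pP.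
have single h : exists x, phi h == [set x].
  suff /cards1P [x ->] : #|phi h| == 1%N by exists x.
  by rewrite eqn_leq card_gt0 p0 leqNgt l1.
pose f h := xchoose (single h).
have fP h : phi h = [set f h] by apply/eqP; exact: (xchooseP (single h)).
pose g x := xchoose (existsP (cov x)).
have gP x : x \in phi (g x) by exact: (xchooseP (existsP (cov x))).
apply: (@spanning_is_minor _ f).
  exists g => [h|x]; last by have := gP x; rewrite fP inE => /eqP.
  apply/eqP; apply: contraTT (gP (f h)) => /pd.
  by rewrite disjoint_sym (fP h) disjoints1.
by move=> h k /pt /touchP [x [y []]]; rewrite !fP !inE => /eqP -> /eqP ->.
Qed.

End ModelMinor.

(** * Dense graphs have complete minors *)

Section CliqueMinor.
Variable G : sgraph.
Implicit Types U W : {set G}.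

Definition nbrs W x := [set y in W | adj G x y].
(** Twice the number of edges induced by [W]. *)
Definition degsum W := (\sum_(x in W) #|nbrs W x|)%N.
Definition bdry W U := [set y in W :\: U | touch U [set y]].

(** A list of branch sets, so that the induction on [k] only has to add a head. *)
Definition clique_model k W := exists s : seq {set G},
  [/\ size s = k, all (fun U => [&& U != set0, U \subset W & conn U]) s &
      pairwise (fun U V => [disjoint U & V] && touch U V) s].

Lemma clique_modelS k W W' : W \subset W' -> clique_model k W -> clique_model k W'.
Proof.
move=> WW' [s [sk sW sp]]; exists s; split=> //; apply: sub_all sW => U.
by case/and3P => -> /subset_trans -> // ->.
Qed.

Lemma nbrsE W x : #|nbrs W x| = (\sum_(y in W) adj G x y)%N.
Proof.
rewrite -sum1_card big_mkcond [RHS]big_mkcond; apply: eq_bigr => y _.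
by rewrite inE; case: (y \in W); case: adj.
Qed.

Lemma degsumE W : degsum W = (\sum_(x in W) \sum_(y in W) adj G x y)%N.
Proof. by apply: eq_bigr => x _; exact: nbrsE. Qed.

Lemma degsum_rem W x : x \in W ->
  degsum W = (degsum (W :\ x) + 2 * #|nbrs (W :\ x) x|)%N.
Proof.
move=> xW; rewrite !degsumE nbrsE (big_setD1 x) //= (big_setD1 x (A := W)) //= adj_irr.
rewrite [X in _ + X = _](eq_bigr (fun y => adj G x y + \sum_(z in W :\ x) adj G y z)%N) => [|y _].
  rewrite big_split /=. lia.
by rewrite (big_setD1 x) //= adj_sym.
Qed.

Lemma degsum_nbrs_ge k W : (forall x, x \in W -> k <= #|nbrs W x|)%N ->
  (k * #|W| <= degsum W)%N.
Proof.
move=> h; rewrite mulnC -sum_nat_const; exact: leq_sum.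
Qed.

(* Contracting a maximal connected [U] that keeps the density of [W] leaves
   every vertex of the boundary of [U] with many neighbours in that boundary. *)
Lemma mader k W : W != set0 -> (2 ^ k * #|W| <= degsum W)%N ->
  clique_model k.+1 W.
Proof.
elim: k W => [|k IHk] W.
  case/set0Pn => x xW _; exists [:: [set x]]; split=> //=.
  by rewrite conn1 sub1set xW !andbT; apply/set0Pn; exists x; rewrite inE.
have [m] := ubnP #|W|; elim: m W => // m IHm W; rewrite ltnS => Wm W0 dW.
(* Contracting [U] in [G[W]] leaves [|W \ U| + 1] vertices and degree sum
   [degsum (W \ U) + 2 |bdry W U|]; the last clause asks that the density bound survive. *)
pose ok U := [&& U != set0, U \subset W, conn U &
  2 ^ k.+1 * (#|W :\: U|).+1 <= degsum (W :\: U) + 2 * #|bdry W U|].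
have [x xW] := set0Pn _ W0.
have okx : ok [set x].
  rewrite /ok conn1 sub1set xW /=; apply/andP; split.
    by apply/set0Pn; exists x; rewrite inE.
  have -> : bdry W [set x] = nbrs (W :\ x) x.
    apply/setP => y; rewrite !inE; congr (_ && _).
    apply/touchP/idP => [[a [b []]]|xy]; first by rewrite !inE => /eqP -> /eqP ->.
    by exists x, y; rewrite !inE.
  by rewrite -degsum_rem //; move: dW; rewrite (cardsD1 x W) xW.
have [U /maxsetP [/and4P [U0 UW cU dU] maxU] _] := maxset_exists okx.
have WU : #|W :\: U| < #|W|.
  rewrite -(cardsID U W) (setIidPr UW) -[X in (X < _)%N]add0n ltn_add2r card_gt0 //.
(* With an empty boundary the contracted vertex is isolated, so [W :\: U] is itself dense and
   smaller, and the inner induction applies. *)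
case: (bdry W U =P set0) => [b0|/eqP b0].
  move: dU; rewrite b0 cards0 muln0 addn0 => dU.
  apply: (clique_modelS (subsetDl W U)); apply: IHm.
  - by apply: leq_trans WU _.
  - apply: contraTneq dU => ->; rewrite /degsum big_set0 cards0 muln1 leqn0.
    by rewrite expn_eq0.
  by apply: leq_trans dU; rewrite leq_mul2l leqnSn orbT.
(* Moving [w] into [U] costs one vertex and exactly [2 (|nbrs (bdry W U) w| + 1)] in degree sum. By
   maximality of [U] this loss exceeds [2 ^ k.+1]. *)
have deg w : w \in bdry W U -> 2 ^ k <= #|nbrs (bdry W U) w|.
  move=> wb; have : (w \in W :\: U) && touch U [set w] by move: wb; rewrite inE.
  case/andP => wWU tw; pose U' := U :|: [set w].
  have [wU wW] : w \notin U /\ w \in W by move: wWU; rewrite inE => /andP[].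
  have WU' : W :\: U' = (W :\: U) :\ w by rewrite /U' setDDl.
  have nok : ~~ ok U'.
    apply/negP => /maxU e; case/negP: wU; rewrite -e ?subsetUl //.
    by rewrite /U' !inE eqxx orbT.
  move: nok; rewrite /ok connU ?conn1 // subUset UW sub1set wW /=.
  have -> /= : U' != set0 by apply/set0Pn; exists w; rewrite !inE eqxx orbT.
  rewrite -ltnNge WU' => nok.
  have dE := degsum_rem wWU.
  have cE : #|W :\: U| = (#|(W :\: U) :\ w|).+1 by rewrite (cardsD1 w (W :\: U)) wWU.
  (* The neighbours of [w] that newly enter the boundary; their number cancels between [nE] and
     [bE]. *)
  pose q := #|nbrs ((W :\: U) :\ w) w :\: bdry W U|.
  have nE : #|nbrs ((W :\: U) :\ w) w| = #|nbrs (bdry W U) w| + q.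
    rewrite -(cardsID (bdry W U)); congr (_ + _); apply: eq_card => y.
    rewrite !inE; case: (y =P w) => [->|_] /=; first by rewrite adj_irr andbF.
    by case: (y \in U); case: (y \in W); case: adj; case: touch.
  have bE : #|bdry W U'| + 1 = #|bdry W U| + q.
    have -> : #|bdry W U| = #|bdry W U :\ w| + 1 by rewrite (cardsD1 w (bdry W U)) wb addnC.
    rewrite addnAC; congr (_ + 1); rewrite -(cardsID (bdry W U) (bdry W U')) ; congr (_ + _).
      apply: eq_card => y; rewrite !inE negb_or.
      case: (y =P w) => [->|_] /=; first by rewrite !andbF.
      case: (y \in U) => //=; case: (y \in W) => //=.
      case ty: (touch U [set y]); rewrite ?andbF // andbT.
      have /touchP [a [b [aU bw ab]]] := ty.
      by apply/touchP; exists a, b; split=> //; rewrite inE aU.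
    apply: eq_card => y; rewrite !inE negb_or.
    case: (y =P w) => [->|_] /=; first by rewrite !andbF.
    case: (y \in U) => //=; case: (y \in W) => //=.
    case ty: (touch U [set y]) => //=.
    apply/touchP/idP => [[a [b []]]|wy].
      rewrite !inE => /orP[aU /eqP -> ab|/eqP -> /eqP -> //].
      by case/negP: (negbT ty); apply/touchP; exists a, y; rewrite inE eqxx.
    by exists w, y; rewrite !inE eqxx orbT.
  rewrite cE in dU; rewrite dE nE in dU.
  move: bE dU nok; rewrite mulnS; move: (2 ^ k.+1 * _.+1) => Z; rewrite expnS.
  move: (2 ^ k) #|nbrs _ _| #|bdry _ U| #|bdry _ U'| (degsum _); clear; lia.
(* The boundary contains a smaller clique model, and [U] touches every subset of its boundary that
   is not empty. *)
have [s [sk sW sp]] := IHk _ b0 (degsum_nbrs_ge deg).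
exists (U :: s); rewrite /= sk sp U0 UW cU; split=> //.
  apply: sub_all sW => V /and3P[-> VW ->]; rewrite andbT.
  by apply: subset_trans VW _; apply/subsetP => y; rewrite !inE => /andP[/andP[]].
rewrite andbT; apply: sub_all sW => V /and3P[/set0Pn [y yV] /subsetP VW _].
apply/andP; split.
  apply/pred0P => z /=; apply/negP => /andP[zU /VW].
  by rewrite !inE zU.
have := VW y yV; rewrite inE => /andP[_ /touchP [a [b [aU]]]].
by rewrite inE => /eqP -> ab; apply/touchP; exists a, y.
Qed.

Lemma clique_model_model k W : clique_model k W -> model (complete k) G.
Proof.
case=> s [sk /allP sW sp]; exists (fun i : 'I_k => nth set0 s i).
have mem_s (i : 'I_k) : nth set0 s i \in s by rewrite mem_nth // sk.
have pw (i j : 'I_k) : i != j -> [disjoint nth set0 s i & nth set0 s j] &&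
    touch (nth set0 s i) (nth set0 s j).
  rewrite neq_ltn => /orP[] ij.
    by apply: (pairwiseP set0 sp) => //; rewrite inE sk.
  by rewrite disjoint_sym touch_sym; apply: (pairwiseP set0 sp) => //; rewrite inE sk.
split=> [i|i|i j /pw /andP[]//|i j /pw /andP[]//].
  by have /and3P[] := sW _ (mem_s i).
by have /and3P[] := sW _ (mem_s i).
Qed.

End CliqueMinor.

(** * Minors built from a set and its common neighbours *)

Section JoinModel.
Variables (G : sgraph) (T : {set G}).

Definition common := [set y | [forall x in T, adj G x y]].

Lemma commonP x y : x \in T -> y \in common -> adj G x y.
Proof. by move=> xT; rewrite inE => /forall_inP; apply. Qed.

Lemma common_disj y : y \in common -> y \notin T.
Proof. by move=> yB; apply/negP => yT; have := commonP yT yB; rewrite adj_irr. Qed.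

(** The enumerations are matched position by position; the default [y0] keeps the values in [Y] even
    off [X]. *)
Lemma exists_inj_in (I J : finType) (X : {set I}) (Y : {set J}) :
  Y != set0 -> (#|X| <= #|Y|)%N ->
  exists2 f : I -> J, {in X &, injective f} & forall x, f x \in Y.
Proof.
move=> /set0Pn [y0 y0Y] le.
pose f x := nth y0 (enum Y) (index x (enum X)).
exists f; last first.
  move=> x; rewrite /f; case: (ltnP (index x (enum X)) (size (enum Y))) => h.
    by rewrite -mem_enum mem_nth.
  by rewrite nth_default.
have lt x : x \in X -> index x (enum X) < size (enum Y).
  move=> xX; apply: leq_trans (_ : size (enum X) <= _); first by rewrite index_mem mem_enum.
  by rewrite -!cardE.
move=> x x' xX x'X /eqP; rewrite nth_uniq ?enum_uniq ?lt // => /eqP.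
rewrite -!(mem_enum X) in xX x'X; move=> e.
by rewrite -(nth_index x xX) e nth_index.
Qed.

(* The vertices in [S0] become the edges joining [T] to distinct common
   neighbours, the other vertices become single common neighbours. *)
Lemma join_model (H : sgraph) (S0 : {set H}) (beta : H -> G) :
  #|S0| = #|T| -> injective beta -> (forall h, beta h \in common) ->
  (forall h k, h \notin S0 -> k \notin S0 -> adj H h k -> adj G (beta h) (beta k)) ->
  model H G.
Proof.
move=> cS bi bB ba.
have [tau [ti tT]] : exists tau : H -> G, {in S0 &, injective tau} /\
    (forall h, h \in S0 -> tau h \in T).
  case: (T =P set0) => [T0|/eqP T0].
    exists beta; split; first exact: in2W.
    by move: cS; rewrite T0 cards0 => /cards0_eq -> h; rewrite inE.
  have [|tau ti tT] := @exists_inj_in _ _ S0 T T0; first by rewrite cS.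
  by exists tau; split.
pose phi h := if h \in S0 then [set tau h; beta h] else [set beta h].
have bphi h : beta h \in phi h by rewrite /phi; case: ifP => _; rewrite !inE eqxx ?orbT.
have tphi h : h \in S0 -> tau h \in phi h by move=> hS; rewrite /phi hS !inE eqxx.
have phiP h x : x \in phi h -> (h \in S0 /\ x = tau h) \/ x = beta h.
  rewrite /phi; case: ifP => hS; rewrite !inE; last by move/eqP; right.
  by case/orP => /eqP ->; [left|right].
have tb h k : h \in S0 -> tau h <> beta k.
  by move=> hS e; have := common_disj (bB k); rewrite -e tT.
exists phi; split.
- by move=> h; apply/set0Pn; exists (beta h).
- move=> h; rewrite /phi; case: ifP => hS; last exact: conn1.
  by apply: conn2; apply: commonP; rewrite ?tT.
- move=> h k nhk; apply/pred0P => x /=; apply/negP => /andP[].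
  move=> /phiP [[hS xh]|xh] /phiP [[kS xk]|xk]; move: xk; rewrite xh.
  + by move/ti => /(_ hS kS) e; rewrite e eqxx in nhk.
  + exact: tb.
  + by move/esym; apply: tb.
  + by move/bi => e; rewrite e eqxx in nhk.
(* A pair meeting [S0] touches through the complete bipartite graph between [T] and [common T]; only
   pairs outside [S0] need an edge of [G] inside [common T]. *)
move=> h k hk; apply/touchP.
case: (boolP (h \in S0)) => hS.
  by exists (tau h), (beta k); split; rewrite ?tphi //; apply: commonP; rewrite ?tT.
case: (boolP (k \in S0)) => kS.
  exists (beta h), (tau k); split; rewrite ?tphi // adj_sym; apply: commonP; rewrite ?tT //.
by exists (beta h), (beta k); split; rewrite // ba.
Qed.

End JoinModel.

(** Turns a bound on the common neighbours of [t + 1] vertices into a bound on the neighbours in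
    [common T] of one further vertex. *)
Lemma common_setU1 (G : sgraph) (T : {set G}) v :
  common (v |: T) = nbrs (common T) v.
Proof.
apply/setP => z; rewrite [RHS]inE ![_ \in common _]inE andbC.
apply/forall_inP/andP => [h|[vz /forall_inP h]].
  split; first by apply: h; exact: setU11.
  by apply/forall_inP => y yT; apply: h; exact: setU1r.
by move=> y /setU1P[->//|/h].
Qed.

(** * Embedding the extremal graphs *)

(** Matched pairs are put at the front, at positions [2 i] and [2 i + 1], and unmatched vertices
    after them, so that half the index names the pair. This is the order in which the copies of
    [K_2] in [F_graph] are numbered. *)
Lemma matching_enum (V : finType) (e : rel V) (W : {set V}) :
  symmetric e -> irreflexive e -> (forall x y z, e x y -> e x z -> y = z) ->
  exists s : seq V, [/\ uniq s, s =i W &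
    forall x y, x \in W -> y \in W -> e x y -> (index x s)./2 = (index y s)./2].
Proof.
move=> es ei ef; have [m] := ubnP #|W|; elim: m W => // m IH W; rewrite ltnS => Wm.
case: (boolP [exists x in W, exists y in W, e x y]) => [|no]; last first.
  exists (enum W); split=> [|x|x y xW yW xy]; first exact: enum_uniq.
    by rewrite mem_enum.
  by case/exists_inP: no; exists x => //; apply/exists_inP; exists y.
move=> /exists_inP [x xW /exists_inP [y yW xy]].
have yx : y != x by apply: contraTneq xy => ->; rewrite ei.
have [|s [us sW sp]] := IH (W :\ x :\ y).
  by move: Wm; rewrite (cardsD1 x W) xW (cardsD1 y (W :\ x)) !inE yx yW /=; apply: leq_trans.
have [xs ys] : x \notin s /\ y \notin s by rewrite !sW !inE !eqxx !andbF.
exists [:: x, y & s]; split.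
- by rewrite /= inE negb_or eq_sym yx xs ys us.
- move=> z; rewrite !inE sW !inE.
  by case: (z =P x) => [->|_] /=; [rewrite xW|case: (z =P y) => [->|]].
have part a b : e a b -> a \in [:: x; y] -> b \in [:: x; y].
  move=> ab; rewrite !inE => /orP[]/eqP aE; rewrite aE in ab.
    by rewrite (ef _ _ _ ab xy) eqxx orbT.
  by rewrite es in xy; rewrite (ef _ _ _ ab xy) eqxx.
have idx a : a \in [:: x; y] -> (index a [:: x, y & s])./2 = 0.
  by rewrite !inE => /orP[]/eqP->; rewrite /= ?eqxx // eq_sym (negbTE yx).
have idx' a : a \notin [:: x; y] -> index a [:: x, y & s] = (index a s).+2.
  by rewrite !inE negb_or /= => /andP[ax ay]; rewrite eq_sym (negbTE ax) eq_sym (negbTE ay).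
move=> a b aW bW ab.
case: (boolP (a \in [:: x; y])) => axy; first by rewrite !idx // (part a).
have bxy : b \notin [:: x; y].
  by apply: contra axy; apply: part; rewrite es.
rewrite !idx' //= (sp a b) // !inE.
  by move: axy; rewrite !inE negb_or => /andP[-> ->].
by move: bxy; rewrite !inE negb_or => /andP[-> ->].
Qed.

Lemma card_S_graph n t : (t <= n)%N -> #|S_graph n t| = n.
Proof. by move=> tn; rewrite card_sum !card_ord subnKC. Qed.

Lemma card_F_graph n t : (t <= n)%N -> #|F_graph n t| = n.
Proof.
move=> tn; rewrite !card_sum card_prod !card_ord.
by rewrite muln2 [(_.*2 + _)%N]addnC odd_double_half subnKC.
Qed.

Lemma join_dominating t (H : sgraph) :
  exists2 U : {set gjoin (complete t) H}, #|U| = t &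
    forall u w, u \in U -> w != u -> adj (gjoin (complete t) H) u w.
Proof.
exists [set inl i | i : 'I_t].
  by rewrite card_imset ?card_ord //; exact: inl_inj.
by move=> _ w /imsetP [i _ ->]; case: w => [j|j] //=; rewrite eq_sym.
Qed.

Section Embeddings.
Variables (G : sgraph) (n t : nat) (T : {set G}).
Hypothesis t0 : (0 < t)%N.
Hypothesis cG : #|G| = n.
Hypothesis cT : #|T| = t.

Let tn : (t <= n)%N. Proof. by rewrite -cT -cG max_card. Qed.

(* [pos] lists the vertices of [H] in order, to be matched with [s]. *)
Lemma join_bijection (H : sgraph) (pos : H -> nat) (s : seq G) :
  #|gjoin (complete t) H| = n -> injective pos -> (forall h, pos h < n - t)%N ->
  uniq s -> s =i ~: T ->
  exists g : gjoin (complete t) H -> G, [/\ bijective g,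
    forall a b, g a \in T -> b != a -> adj (gjoin (complete t) H) a b &
    forall a, g a \notin T ->
      exists2 h, a = inr h & [/\ g a \in s & index (g a) s = pos h]].
Proof.
move=> cH posi poslt us sT.
have [v0 v0T] : exists v0, v0 \in T by apply/set0Pn; rewrite -card_gt0 cT.
have ss : size s = (n - t)%N.
  by rewrite -(card_uniqP us) (eq_card sT) -cG -(cardsC T) cT addKn.
pose g (a : gjoin (complete t) H) := match a with
  | inl i => nth v0 (enum T) i | inr h => nth v0 s (pos h) end.
have szT (i : 'I_t) : (i < size (enum T))%N by rewrite -cardE cT.
have szs h : (pos h < size s)%N by rewrite ss.
have gl (i : 'I_t) : g (inl i) \in T by rewrite -mem_enum mem_nth // -cardE cT.
have gs h : g (inr h) \in s by rewrite mem_nth // ss poslt.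
have gr h : g (inr h) \notin T by have := gs h; rewrite sT inE.
exists g; split.
- apply: inj_card_bij; last by rewrite cH cG.
  move=> [i|h] [j|k] e.
  + congr inl; apply/val_inj/eqP; rewrite -(nth_uniq v0 (szT i) (szT j) (enum_uniq T)).
    exact/eqP.
  + by have := gr k; rewrite -e gl.
  + by have := gr h; rewrite e gl.
  congr inr; apply/posi/eqP; rewrite -(nth_uniq v0 (szs h) (szs k) us); exact/eqP.
- move=> [i|h] b; last by rewrite (negbTE (gr h)).
  by move=> _; case: b => [j|k] //=; rewrite eq_sym.
move=> [i|h]; first by rewrite gl.
by move=> _; exists h => //; rewrite gs index_uniq // ss.
Qed.

Lemma S_embedding :
  (forall x y, x \in common T -> y \in common T -> ~~ adj G x y) ->
  exists g : S_graph n t -> G, [/\ bijective g,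
    forall a b, g a \in T -> b != a -> adj (S_graph n t) a b &
    forall a b, g a \in common T -> g b \in common T ->
      adj G (g a) (g b) -> adj (S_graph n t) a b].
Proof.
move=> no; have [||h|||g [gb gd _]] := @join_bijection (gcompl (complete (n - t))) val (enum (~: T)).
- exact: card_S_graph.
- exact: val_inj.
- exact: ltn_ord.
- exact: enum_uniq.
- by move=> z; rewrite mem_enum.
by exists g; split=> // a b aB bB ab; have := no _ _ aB bB; rewrite ab.
Qed.

Lemma F_embedding :
  (forall x y z, x \in common T -> y \in common T -> z \in common T ->
     adj G x y -> adj G x z -> y = z) ->
  exists g : F_graph n t -> G, [/\ bijective g,
    forall a b, g a \in T -> b != a -> adj (F_graph n t) a b &
    forall a b, g a \in common T -> g b \in common T ->
      adj G (g a) (g b) -> adj (F_graph n t) a b].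
Proof.
move=> fu; pose e : rel G := fun x y => [&& x \in common T, y \in common T & adj G x y].
have [|||s [us sT sp]] := @matching_enum _ e (~: T).
- by move=> x y; rewrite /e adj_sym andbCA.
- by move=> x; rewrite /e adj_irr !andbF.
- move=> x y z /and3P[xB yB xy] /and3P[_ zB xz]; exact: (fu x y z).
pose H := gunion (copies (n - t)./2 (complete 2)) (complete (odd (n - t))).
pose pos (h : H) : nat := match h with
  | inl u => u.1.*2 + u.2 | inr k => (n - t)./2.*2 + k end.
(* Half of [pos] is the number of the copy of [K_2]; the vertex left over for odd [n - t] comes last
   and gets a number of its own. *)
have half_pos (u : 'I_((n - t)./2) * 'I_2) : (u.1.*2 + u.2)./2 = u.1.
  by rewrite halfD doubleK odd_double /= add0n; case: u.2 => [[|[|m]] ?] //=; rewrite addn0.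
have half_end (k : 'I_(odd (n - t))) : ((n - t)./2.*2 + k)./2 = (n - t)./2.
  case: k; case: (odd (n - t)) => // [[|m]] // ?; by rewrite addn0 doubleK.
have nE := odd_double_half (n - t).
have posi : injective pos.
  move=> [[u1 u2]|k] [[v1 v2]|l] /= E.
  - have E1 : u1 = v1 by apply: val_inj; rewrite -[LHS](half_pos (u1, u2)) -[RHS](half_pos (v1, v2)) /= E.
    by move: E; rewrite E1 => /addnI /val_inj ->.
  - have := half_pos (u1, u2); rewrite /= E half_end => E1.
    by have := ltn_ord u1; rewrite /= -E1 ltnn.
  - have := half_pos (v1, v2); rewrite /= -E half_end => E1.
    by have := ltn_ord v1; rewrite /= -E1 ltnn.
  by congr inr; apply: val_inj; apply: addnI E.
have [||h|||g [gb gd gi]] := @join_bijection H pos s.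
- exact: card_F_graph.
- exact: posi.
- case: h => [[u1 u2]|k] /=.
    by have := ltn_ord u1; have := ltn_ord u2; move: nE; lia.
  by have := ltn_ord k; move: nE; lia.
- exact: us.
- exact: sT.
exists g; split=> // a b aB bB ab.
have aT := common_disj aB; have bT := common_disj bB.
have := sp (g a) (g b); rewrite !in_setC aT bT /e aB bB ab => /(_ isT isT isT).
have nab : a <> b by move=> eab; rewrite eab adj_irr in ab.
have [h ah [_ ->]] := gi a aT; have [k bk [_ ->]] := gi b bT.
move: nab; rewrite {}ah {}bk {ab aB bB aT bT}.
(* Equal halves put distinct vertices in the same copy of [K_2], where they are adjacent; the mixed
   cases are out of range. *)
case: h k => [u|h] [v|k] /= nab; rewrite ?half_pos ?half_end => E.
- have E1 : u.1 = v.1 by apply: val_inj.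
  rewrite /copies_rel E1 eqxx /=; apply/eqP => E2; apply: nab.
  by move: E1 E2; case: u {E}; case: v => a2 b2 a1 b1 /= -> ->.
- by have := ltn_ord u.1; rewrite E ltnn.
- by have := ltn_ord v.1; rewrite -E ltnn.
rewrite /complete_rel; apply: contra_notN nab => /eqP -> //.
Qed.

End Embeddings.

(** * Structure of graphs without the forbidden minor *)

Section ForbiddenMinor.
Variables (r : nat) (M : {set {set 'I_r}}) (G : sgraph).
Hypothesis r4 : (4 <= r)%N.
Hypothesis G_free : minor_free (@del_edges (complete r) M) G.
Local Notation H := (@del_edges (complete r) M).

Let no_model : ~ model H G. Proof. by move=> /model_is_minor. Qed.

(** A denser [W] would contain a model of [K_r] by [mader], hence one of its subgraph [H]. *)
Lemma free_sparse (W : {set G}) : (degsum W <= 2 ^ r.-1 * #|W|)%N.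
Proof.
case: (W =P set0) => [->|/eqP W0]; first by rewrite /degsum big_set0.
rewrite leqNgt; apply/negP => /ltnW /(mader W0) /clique_model_model.
rewrite prednK; last by apply: leq_trans r4.
move=> m; apply: no_model; apply: (@model_sub (complete r) H G id) m => //.
by move=> h k /andP[].
Qed.

(** With [r] common neighbours, the [r - 2] vertices other than [a] and [b] are paired with [T],
    while [a] and [b] become single common neighbours; they need no edge, since [ab] is deleted. *)
Lemma free_few_common (a b : 'I_r) (T : {set G}) : a != b -> [set a; b] \in M ->
  #|T| = (r - 3).+1 -> (#|common T| < r)%N.
Proof.
move=> ab abM cT; rewrite ltnNge; apply/negP => le.
have B0 : common T != set0 by rewrite -card_gt0; apply: leq_trans le; apply: leq_trans r4.
have [|beta bi bB] := @exists_inj_in 'I_r G setT (common T) B0; first by rewrite cardsT card_ord.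
apply: no_model; apply: (@join_model G T H (~: [set a; b]) beta) => //.
- have aux m : 2 + m = r -> m = (r - 3).+1 by move: r4; lia.
  by rewrite cT; apply: aux; have := cardsC [set a; b]; rewrite cards2 ab card_ord.
- by move=> h k; apply: bi; rewrite in_setT.
move=> h k; rewrite !inE !negbK => hab kab /andP[hk hkM]; case/negP: hkM.
move: hk; rewrite /= /complete_rel.
by case/orP: hab => /eqP ->; case/orP: kab => /eqP ->; rewrite ?eqxx // setUC.
Qed.

(** The [r - 3] vertices other than [a], [b], [c] are paired with [T], and [a], [b], [c] sit at [x],
    [y], [z], where each pair is adjacent or deleted by [M]. Both cases of the theorem exclude
    subgraphs of [G[common T]] in this way. *)
Lemma free_join (a b c : 'I_r) (x y z : G) (T : {set G}) :
  uniq [:: a; b; c] -> uniq [:: x; y; z] ->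
  #|T| = (r - 3)%N -> (r <= #|common T|)%N ->
  x \in common T -> y \in common T -> z \in common T ->
  (adj G x y || ([set a; b] \in M)) -> (adj G y z || ([set b; c] \in M)) ->
  (adj G x z || ([set a; c] \in M)) -> False.
Proof.
move=> abc xyz cT cB xB yB zB xy yz xz.
have [ab ac bc] : [/\ a != b, a != c & b != c].
  by move: abc; rewrite /= !inE negb_or => /andP[/andP[-> ->]]; rewrite andbT.
have [nxy nxz nyz] : [/\ x != y, x != z & y != z].
  by move: xyz; rewrite /= !inE negb_or => /andP[/andP[-> ->]]; rewrite andbT.
pose S0 := ~: [set k in [:: a; b; c]].
pose B' := common T :\: [set v in [:: x; y; z]].
have cS0 : (#|S0| = r - 3)%N.
  have aux m : 3 + m = r -> m = (r - 3)%N by move=> <-; rewrite addKn.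
  apply: aux; have := cardsC [set k in [:: a; b; c]].
  by rewrite cardsE (card_uniqP abc) card_ord.
(* After reserving [x], [y], [z] there are still enough common neighbours for all of [S0]. *)
have cB' : (r - 3 <= #|B'|)%N.
  rewrite cardsD leq_sub // (leq_trans (subset_leq_card (subsetIr _ _))) //.
  by rewrite cardsE (card_uniqP xyz).
have B'0 : B' != set0 by rewrite -card_gt0; apply: leq_trans cB'; rewrite subn_gt0.
have [|beta0 bi0 bB0] := @exists_inj_in 'I_r G S0 B' B'0; first by rewrite cS0.
pose beta k := if k == a then x else if k == b then y else if k == c then z else beta0 k.
have ba : beta a = x by rewrite /beta eqxx.
have bb : beta b = y by rewrite /beta eq_sym (negbTE ab) eqxx.
have bc' : beta c = z by rewrite /beta eq_sym (negbTE ac) eq_sym (negbTE bc) eqxx.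
have b0 k : k \in S0 -> beta k = beta0 k.
  by rewrite !inE !negb_or /beta => /and3P[/negbTE ka /negbTE kb /negbTE kc]; rewrite ka kb kc.
have inS k : k \notin S0 -> [\/ k = a, k = b | k = c].
  by rewrite !inE negbK => /or3P[]/eqP; [constructor 1|constructor 2|constructor 3].
have b0n k : k \in S0 -> [/\ beta k != x, beta k != y & beta k != z].
  by move=> /b0 ->; have := bB0 k; rewrite !inE !negb_or => /andP[/and3P[]].
apply: no_model; apply: (@join_model G T H S0 beta).
- by rewrite cS0 cT.
- move=> h k; case: (boolP (h \in S0)) => hS; case: (boolP (k \in S0)) => kS.
  + by rewrite !b0 //; apply: bi0.
  + have [h1 h2 h3] := b0n h hS.
    by case: (inS k kS) => ->; rewrite ?ba ?bb ?bc' => /eqP; rewrite (negbTE h1, negbTE h2, negbTE h3).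
  + have [h1 h2 h3] := b0n k kS.
    by case: (inS h hS) => -> /esym; rewrite ?ba ?bb ?bc' => /eqP; rewrite (negbTE h1, negbTE h2, negbTE h3).
  case: (inS h hS) => ->; case: (inS k kS) => -> //; rewrite ?ba ?bb ?bc' => /eqP;
  by rewrite ?(negbTE nxy, negbTE nxz, negbTE nyz) // eq_sym ?(negbTE nxy, negbTE nxz, negbTE nyz).
- move=> k; case: (boolP (k \in S0)) => kS.
    by rewrite b0 //; have := bB0 k; rewrite inE => /andP[].
  by case: (inS k kS) => ->; rewrite ?ba ?bb ?bc'.
move=> h k hS kS /andP[hk hkM].
case: (inS h hS) hk hkM => ->; case: (inS k kS) => ->; rewrite ?ba ?bb ?bc' /= /complete_rel ?eqxx //= => _ hkM.
- by move: xy; rewrite (negbTE hkM) orbF.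
- by move: xz; rewrite (negbTE hkM) orbF.
- by move: xy; rewrite setUC (negbTE hkM) orbF adj_sym.
- by move: yz; rewrite (negbTE hkM) orbF.
- by move: xz; rewrite setUC (negbTE hkM) orbF adj_sym.
by move: yz; rewrite setUC (negbTE hkM) orbF adj_sym.
Qed.

End ForbiddenMinor.

Local Open Scope ring_scope.

(** * Spectral radius and quadratic form *)

Local Open Scope sesquilinear_scope.

(** The order of [C] is partial; norms are real, hence comparable, which makes the iterated maximum
    a true upper bound. *)
Lemma bigmax_norm_ge (C : numClosedFieldType) (s : seq C) (z : C) :
  z \in s -> `|z| <= \big[Num.max/0]_(y <- s) `|y|.
Proof.
have real_max (s' : seq C) : \big[Num.max/0]_(y <- s') `|y| \is Num.real.
  by elim/big_ind: _ => // [x y xR yR|x _]; [apply: max_real | apply: normr_real].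
elim: s => [|a s IH] //; rewrite inE big_cons.
have Ra := normr_real a; have Rs := real_max s.
case/orP => [/eqP ->|/IH H]; rewrite comparable_le_max ?lexx ?H ?orbT //;
  exact: real_comparable.
Qed.

Lemma bigmax_norm_mem (C : numClosedFieldType) (s : seq C) : s != [::] ->
  exists2 z : C, z \in s & \big[Num.max/0]_(y <- s) `|y| = `|z|.
Proof.
elim: s => [|a s IH] // _; rewrite big_cons.
case: (s =P [::]) => [->|/eqP /IH [z zs ->]].
  exists a; first by rewrite inE.
  by rewrite big_nil max_l.
rewrite /Num.max; case: ifP => _; first by exists z; rewrite // inE zs orbT.
by exists a; rewrite // inE eqxx.
Qed.

Lemma spectral_radius_ge0 n (A : 'M[algC]_n) : 0 <= spectral_radius A.
Proof.
rewrite /spectral_radius; elim/big_ind: _ => // x y x0 y0.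
by rewrite /Num.max; case: ifP.
Qed.

Lemma char_poly_normal_mem n (A : 'M[algC]_n) (z : algC) :
  (z \in sval (closed_field_poly_normal (char_poly A))) = eigenvalue A z.
Proof.
case: closed_field_poly_normal => s /= ds.
rewrite eigenvalue_root_char ds (monicP (char_poly_monic A)) scale1r.
by rewrite root_prod_XsubC.
Qed.

Lemma eigenvalue_le_radius n (A : 'M[algC]_n) (z : algC) :
  eigenvalue A z -> `|z| <= spectral_radius A.
Proof. by rewrite -char_poly_normal_mem => /bigmax_norm_ge. Qed.

Lemma radius_eigenvalue n (A : 'M[algC]_n) : (0 < n)%N ->
  exists2 z, eigenvalue A z & spectral_radius A = `|z|.
Proof.
move=> n0; have : sval (closed_field_poly_normal (char_poly A)) != [::].
  have [z zA] := eigenvalue_closed A n0; apply: contraTneq zA => s0.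
  by rewrite -char_poly_normal_mem s0.
case/bigmax_norm_mem => z zs e; exists z => //.
by rewrite -char_poly_normal_mem.
Qed.

Section Rayleigh.
Variables (n : nat) (A : 'M[algC]_n).
Hypothesis hermA : A \is hermsymmx.
Let P := spectralmx A.
Let D := spectral_diag A.
Let lam := spectral_radius A.

Let PU : P \is unitarymx. Proof. exact: spectral_unitarymx. Qed.
Let defA : A = P^t* *m diag_mx D *m P.
Proof.
have /hermitian_normalmx /orthomx_spectralP := hermA.
by rewrite invmx_unitary.
Qed.
Let PPt : P *m P^t* = 1%:M. Proof. exact/unitarymxP. Qed.
Let PtP : P^t* *m P = 1%:M. Proof. exact: mulmx1C PPt. Qed.

Lemma spectral_diag_eigenvalue i : eigenvalue A (D 0 i).
Proof.
apply/eigenvalueP; exists (row i P).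
  rewrite -row_mul defA !mulmxA PPt mul1mx row_mul row_diag_mx -scalemxAl -rowE //.
apply/eqP => r0; have := congr1 (fun M : 'M[algC]_n => M i i) PPt.
rewrite !mxE eqxx mulr1n (eq_bigr (fun=> 0)) ?big1 //= => [/esym/eqP|j _].
  by rewrite oner_eq0.
by have := congr1 (fun M : 'rV[algC]_n => M 0 j) r0; rewrite !mxE => ->; rewrite mul0r.
Qed.

Lemma spectral_diag_le i : D 0 i <= lam.
Proof.
apply: le_trans (eigenvalue_le_radius (spectral_diag_eigenvalue i)).
apply: real_ler_norm; have /mxOverP := hermitian_spectral_diag_real hermA.
exact.
Qed.

(** In the coordinates [z] of an orthonormal eigenbasis the difference of the two sides is the sum
    of [(lam - D_i) |z_i|^2], with nonnegative terms. If it vanishes, [z_i = 0] wherever [D_i]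
    differs from [lam]. *)
Lemma hermitian_form_le (u : 'rV[algC]_n) :
  (u *m A *m u^t*) 0 0 <= lam * (u *m u^t*) 0 0 /\
  ((u *m A *m u^t*) 0 0 = lam * (u *m u^t*) 0 0 -> u *m A = lam *: u).
Proof.
pose z := u *m P^t*.
have uz : u = z *m P by rewrite /z -mulmxA PtP mulmx1.
have zt : z^t* = P *m u^t*.
  by rewrite /z trmx_mul map_mxM -map_trmx trmxK -map_mx_comp (map_mx_id (@conjCK _)).
have qE : (u *m A *m u^t*) 0 0 = \sum_i D 0 i * `|z 0 i| ^+ 2.
  rewrite defA !mulmxA -/z -mulmxA -zt mul_mx_diag mxE; apply: eq_bigr => i _.
  by rewrite !mxE normCK mulrAC mulrC mulrA.
have nE : (u *m u^t*) 0 0 = \sum_i `|z 0 i| ^+ 2.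
  rewrite {1}uz -mulmxA -zt mxE; apply: eq_bigr => i _.
  by rewrite !mxE normCK.
have t0 i : 0 <= (lam - D 0 i) * `|z 0 i| ^+ 2.
  by rewrite mulr_ge0 ?exprn_ge0 // subr_ge0 spectral_diag_le.
have dE : lam * (u *m u^t*) 0 0 - (u *m A *m u^t*) 0 0 =
    \sum_i (lam - D 0 i) * `|z 0 i| ^+ 2.
  rewrite qE nE mulr_sumr -sumrB; apply: eq_bigr => i _; by rewrite mulrBl.
split; first by rewrite -subr_ge0 dE sumr_ge0.
move=> e; have /eqP : \sum_i (lam - D 0 i) * `|z 0 i| ^+ 2 = 0.
  by rewrite -dE e subrr.
rewrite psumr_eq0 // => /allP h.
have zD : z *m diag_mx D = lam *: z.
  apply/rowP => i; rewrite mul_mx_diag [LHS]mxE [RHS]mxE.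
  have := h i (mem_index_enum _); rewrite mulf_eq0 expf_eq0 /= normr_eq0 subr_eq0.
  by case/orP => /eqP -> //; rewrite ?mul0r ?mulr0 // mulrC.
by rewrite defA !mulmxA -/z zD -scalemxAl -uz.
Qed.

End Rayleigh.

Lemma adjacency_herm (G : sgraph) : adjacency_mx G \is hermsymmx.
Proof.
apply: realsym_hermsym.
  apply/is_hermitianmxP; rewrite expr0 scale1r map_mx_id //.
  by apply/matrixP => i j; rewrite !mxE adj_sym.
by apply/mxOverP => i j; rewrite mxE realn.
Qed.

(** * The spectral radius as a real number, and Perron vectors *)

Lemma lambda_real (G : sgraph) : lambda G \is Num.real.
Proof. exact/ger0_real/spectral_radius_ge0. Qed.

(** The field [algR] is totally ordered, so the estimates are carried out there. *)
Definition lamR (G : sgraph) : algR := in_algR (lambda_real G).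

Lemma lamR_ge0 (G : sgraph) : 0 <= lamR G.
Proof. exact: spectral_radius_ge0. Qed.

Lemma lamR_le (G H : sgraph) : (lamR G <= lamR H) = (lambda G <= lambda H).
Proof. by []. Qed.

Lemma lamR_eq (G H : sgraph) : lamR G = lamR H <-> lambda G = lambda H.
Proof. by split=> [/(congr1 val)|e] //; apply: val_inj. Qed.

Section GraphRayleigh.
Variable G : sgraph.
Local Notation A := (adjacency_mx G).

Definition row_of (y : G -> algC) : 'rV[algC]_#|G| := \row_i y (enum_val i).

Lemma row_of_mul (y : G -> algC) :
  row_of y *m A = row_of (fun v => \sum_(w | adj G v w) y w).
Proof.
apply/rowP => i; rewrite !mxE [RHS]big_mkcond /= (reindex _ (onW_bij _ (enum_val_bij G))) /=.
apply: eq_bigr => j _; rewrite !mxE adj_sym.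
by case: adj; rewrite ?mulr1 ?mulr0.
Qed.

Lemma row_of_dot (y z : G -> algC) :
  (row_of y *m (row_of z)^t*) 0 0 = \sum_v y v * (z v)^*.
Proof.
rewrite mxE [RHS](reindex _ (onW_bij _ (enum_val_bij G))) /=.
by apply: eq_bigr => j _; rewrite !mxE.
Qed.

Lemma row_ofK (u : 'rV[algC]_#|G|) : u = row_of (fun v => u 0 (enum_rank v)).
Proof. by apply/rowP => i; rewrite !mxE enum_valK. Qed.

Lemma rayleighC (y : G -> algC) : (forall v, y v \is Num.real) ->
  \sum_v (\sum_(w | adj G v w) y w) * y v <= lambda G * \sum_v y v ^+ 2 /\
  (\sum_v (\sum_(w | adj G v w) y w) * y v = lambda G * \sum_v y v ^+ 2 ->
    forall v, \sum_(w | adj G v w) y w = lambda G * y v).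
Proof.
move=> yR; have [] := hermitian_form_le (adjacency_herm G) (row_of y).
rewrite row_of_mul !row_of_dot.
have -> : \sum_v (\sum_(w | adj G v w) y w) * (y v)^* =
          \sum_v (\sum_(w | adj G v w) y w) * y v.
  by apply: eq_bigr => v _; rewrite (CrealP (yR v)).
have -> : \sum_v y v * (y v)^* = \sum_v y v ^+ 2.
  by apply: eq_bigr => v _; rewrite (CrealP (yR v)).
move=> le eq; split=> // /eq /rowP e v.
by have := e (enum_rank v); rewrite !mxE enum_rankK.
Qed.

Lemma rayleigh (y : G -> algR) :
  \sum_v (\sum_(w | adj G v w) y w) * y v <= lamR G * \sum_v y v ^+ 2 /\
  (\sum_v (\sum_(w | adj G v w) y w) * y v = lamR G * \sum_v y v ^+ 2 ->
    forall v, \sum_(w | adj G v w) y w = lamR G * y v).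
Proof.
have [] := @rayleighC (algRval \o y) (fun v => algRvalP (y v)).
have -> : \sum_v (\sum_(w | adj G v w) (algRval \o y) w) * (algRval \o y) v =
          algRval (\sum_v (\sum_(w | adj G v w) y w) * y v).
  by rewrite rmorph_sum; apply: eq_bigr => v _; rewrite rmorphM rmorph_sum.
have -> : lambda G * \sum_v (algRval \o y) v ^+ 2 =
          algRval (lamR G * \sum_v y v ^+ 2).
  by rewrite rmorphM rmorph_sum.
move=> le eq; split=> // /(congr1 algRval) /eq e v; apply: val_inj.
by rewrite /= rmorph_sum; apply: e.
Qed.

(** Let [f] be an eigenvector for an eigenvalue of largest modulus and [y = |f|]. The triangle
    inequality gives [A y >= lambda y] entrywise, so [y] attains the Rayleigh bound and is an
    eigenvector; it is then scaled to maximum 1. Entries may vanish, as [G] may be disconnected. *)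
Lemma perron : (0 < #|G|)%N ->
  exists x : G -> algR, [/\ forall v, 0 <= x v, forall v, x v <= 1,
    exists u, x u = 1 &
    forall v, \sum_(w | adj G v w) x w = lamR G * x v].
Proof.
move=> G0; have [z /eigenvalueP [u uA u0] lz] := radius_eigenvalue A G0.
pose f v := u 0 (enum_rank v).
pose y v : algR := in_algR (normr_real (f v)).
have fA v : \sum_(w | adj G v w) f w = z * f v.
  have := uA; rewrite {1}(row_ofK u) row_of_mul => /rowP/(_ (enum_rank v)).
  by rewrite !mxE enum_rankK.
have y0 v : 0 <= y v by exact: normr_ge0.
have yA v : lamR G * y v <= \sum_(w | adj G v w) y w.
  change (algRval (lamR G * y v) <= algRval (\sum_(w | adj G v w) y w)).
  rewrite rmorphM rmorph_sum /= {1}/lambda lz -normrM -fA.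
  exact: ler_norm_sum.
have [le eq] := rayleigh y.
have {le}eqy : forall v, \sum_(w | adj G v w) y w = lamR G * y v.
  apply: eq; apply/eqP; rewrite eq_le le /= mulr_sumr; apply: ler_sum => v _.
  by rewrite expr2 mulrA ler_wpM2r.
have [m _ maxm] : exists2 m : G, true & forall v, y v <= y m.
  have /card_gt0P [g0 _] := G0.
  have [m _ h] := @arg_maxP _ _ _ g0 xpredT y isT.
  by exists m => // v; apply: h.
have ym : 0 < y m.
  rewrite lt_def y0 andbT; apply: contra u0 => /eqP ym0.
  apply/eqP/rowP => i; rewrite mxE; apply/eqP.
  have := maxm (enum_val i); rewrite ym0 => h.
  have /(congr1 algRval)/eqP : y (enum_val i) = 0 by apply/eqP; rewrite eq_le h y0.
  by rewrite /= normr_eq0 /f enum_valK.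
exists (fun v => y v / y m); split=> [v|v||v].
- by rewrite divr_ge0.
- by rewrite ler_pdivrMr // mul1r.
- by exists m; rewrite divff // gt_eqF.
by rewrite -mulr_suml eqy mulrA.
Qed.

End GraphRayleigh.

Local Close Scope sesquilinear_scope.

(** * Vertices of high degree *)

Section HighDegree.
Variables (R : realFieldType) (G : sgraph) (r t C : nat) (x : G -> R) (lam : R).
Local Notation n := #|G|.
Local Notation N := (nbrs (setT : {set G})).
Hypothesis C0 : (0 < C)%N.
Hypothesis t0 : (0 < t)%N.
Hypothesis sparse : forall W : {set G}, (degsum W <= C * #|W|)%N.
Hypothesis few_common : forall T : {set G}, #|T| = t.+1 -> (#|common T| < r)%N.
Hypothesis x0 : forall v, 0 <= x v.
Hypothesis x1 : forall v, x v <= 1.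
Hypothesis eigen : forall v, \sum_(w | adj G v w) x w = lam * x v.
Hypothesis lam0 : 0 <= lam.

Lemma leq_card_bigcup (I : finType) (A : {set I}) (F : I -> {set G}) :
  (#|\bigcup_(i in A) F i| <= \sum_(i in A) #|F i|)%N.
Proof.
elim/big_rec2: _ => [|i m S _ le]; first by rewrite cards0.
by apply: leq_trans (leq_card_setU _ _) _; rewrite leq_add2l.
Qed.

Lemma in_N v w : (w \in N v) = adj G v w. Proof. by rewrite !inE. Qed.

Lemma eigenN v : \sum_(w in N v) x w = lam * x v.
Proof. by rewrite -eigen; apply: eq_bigl => w; rewrite in_N. Qed.

Definition level (eta : R) := [set v | eta <= x v].

Lemma sum_deg : \sum_v #|N v|%:R <= C%:R * n%:R :> R.
Proof.
rewrite -natr_sum -natrM ler_nat -cardsT; apply: leq_trans (sparse setT).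
by rewrite /degsum [X in (_ <= X)%N](eq_bigl predT) // => v; rewrite inE.
Qed.

Lemma sum_le_card (A : {set G}) : \sum_(v in A) x v <= #|A|%:R.
Proof.
rewrite -sum1_card natr_sum; exact: ler_sum.
Qed.

Lemma level_deg_sum eta (k : R) : 0 <= k ->
  (forall v, eta <= x v -> k <= #|N v|%:R) -> #|level eta|%:R * k <= C%:R * n%:R.
Proof.
move=> k0 h; apply: le_trans sum_deg.
rewrite mulrC mulr_natr -sumr_const.
apply: (@le_trans _ _ (\sum_(v in level eta) #|N v|%:R)).
  by apply: ler_sum => v; rewrite inE => /h.
by rewrite [leRHS](bigID (mem (level eta))) /= lerDl sumr_ge0.
Qed.

(** Entries are at most 1, so the eigenvalue equation gives degree at least [lam * eta] where the
    entry is at least [eta]. *)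
Lemma level_card eta : 0 <= eta -> #|level eta|%:R * (lam * eta) <= C%:R * n%:R.
Proof.
move=> e0; apply: level_deg_sum; first by rewrite mulr_ge0.
move=> v xv; apply: le_trans (sum_le_card (N v)); rewrite eigenN.
exact: ler_wpM2l.
Qed.

(** Expansion over walks of length two from [v]; those ending at an entry below [eta] contribute at
    most [eta] times the sum of all degrees. *)
Lemma two_step eta v : 0 <= eta ->
  lam ^+ 2 * x v <= eta * (C%:R * n%:R) +
    \sum_(w in N v) \sum_(y in N w :&: level eta) x y.
Proof.
move=> e0; have -> : lam ^+ 2 * x v = \sum_(w in N v) \sum_(y in N w) x y.
  rewrite expr2 -mulrA -eigenN mulr_sumr; by apply: eq_bigr => w _; rewrite eigenN.
apply: (@le_trans _ _ (\sum_(w in N v) (eta * #|N w|%:R + \sum_(y in N w :&: level eta) x y))).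
  apply: ler_sum => w _; rewrite (big_setID (level eta)) /= addrC lerD2r.
  apply: (@le_trans _ _ (\sum_(y in N w :\: level eta) eta)).
    by apply: ler_sum => y; rewrite !inE -ltNge => /andP[/ltW].
  rewrite sumr_const -[leLHS]mulr_natr ler_wpM2l // ler_nat.
  exact: subset_leq_card (subsetDl _ _).
rewrite big_split /= lerD2r -mulr_sumr ler_wpM2l //.
apply: le_trans sum_deg.
by rewrite [leRHS](bigID (mem (N v))) /= lerDl sumr_ge0.
Qed.

(** The last steps of the remaining walks are edges inside [N v :|: level eta], whose number is
    bounded by sparsity. *)
Lemma two_step_sparse eta v : 0 <= eta ->
  lam ^+ 2 * x v <= eta * (C%:R * n%:R) + C%:R * (#|N v|%:R + #|level eta|%:R).
Proof.
move=> e0; apply: le_trans (two_step v e0) _; rewrite lerD2l.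
apply: (@le_trans _ _ (\sum_(w in N v) #|N w :&: level eta|%:R)).
  by apply: ler_sum => w _; apply: sum_le_card.
rewrite -natr_sum -natrD -natrM ler_nat.
apply: (@leq_trans (degsum (N v :|: level eta))).
  rewrite /degsum [X in (_ <= X)%N](bigID (mem (N v))) /=; apply: leq_trans (leq_addr _ _).
  rewrite [X in (_ <= X)%N](eq_bigl (mem (N v))) => [|w]; last first.
    by rewrite !inE andbC; case: adj.
  apply: leq_sum => w _; apply: subset_leq_card; apply/subsetP => y.
  by rewrite !inE /= => /andP[-> ->]; rewrite orbT.
apply: leq_trans (sparse _) _; rewrite leq_mul2l; apply/orP; right.
by rewrite cardsU leq_subr.
Qed.

(** [eps] is the threshold for large entries, [K] bounds the number of large vertices, and [M] the
    weight of walks through bad middle vertices. *)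
Variables (eps : R) (K M : nat).
Hypothesis n_gt0 : (0 < n)%N.
Hypothesis eps_gt0 : 0 < eps.
Hypothesis eps_small : 2 * C%:R * eps < 1.
Hypothesis lam_big : 64 * C%:R ^+ 3 <= eps ^+ 2 * lam.
Hypothesis K_big : 4 * C%:R ^+ 2 <= eps * K%:R.
Hypothesis M_big : (K * (r * 2 ^ K) <= M)%N.
Hypothesis n_big : (t ^ 2 + M + r + 1)%:R <= eps * n%:R.
Hypothesis lam_sq : t%:R * (n%:R - t%:R) <= lam ^+ 2.

Let C1 : 1 <= C%:R :> R. Proof. by rewrite ler1n. Qed.
Let t1R : 1 <= t%:R :> R. Proof. by rewrite ler1n. Qed.
Let nR : 0 < n%:R :> R. Proof. by rewrite ltr0n. Qed.
Let eps_half : 2 * eps < 1.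
Proof. by apply: le_lt_trans eps_small; rewrite -mulrA mulrCA -[leLHS]mul1r ler_wpM2r ?mulr_ge0 // ltW. Qed.

Let n_bigR : t%:R ^+ 2 + M%:R + r%:R + 1 <= eps * n%:R.
Proof. by move: n_big; rewrite !natrD natrX. Qed.

Let lam_sq_half : n%:R / 2 <= lam ^+ 2.
Proof.
have c1 := C1; have t1 := t1R; have n1 := nR; have e1 := eps_half.
apply: le_trans lam_sq.
have h1 : t%:R ^+ 2 <= n%:R / 2 :> R.
  have : 0 <= M%:R :> R by [].
  have : 0 <= r%:R :> R by [].
  have : eps * n%:R <= 2^-1 * n%:R by rewrite ler_wpM2r // ; lra.
  by move: n_bigR; lra.
have : n%:R <= t%:R * n%:R :> R by rewrite ler_peMl // ltW.
by rewrite mulrBr -expr2; lra.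
Qed.

Lemma level_degree v : eps <= x v -> eps * n%:R / 4 <= C%:R * #|N v|%:R.
Proof.
have c1 := C1; have t1 := t1R; have n1 := nR; have e1 := eps_half.
(* With this [eta] the small endpoints cost [eps n / 8], and [lam_big] bounds the cost of
   [level eta] by the same; [eps n / 4] remains out of [eps n / 2]. *)
move=> xv; pose eta := eps / (8 * C%:R).
have eta0 : 0 <= eta by rewrite divr_ge0 ?mulr_ge0 // ltW.
have etaC : eta * C%:R = eps / 8 by rewrite /eta; field; rewrite gt_eqF //; lra.
have h := two_step_sparse v eta0.
have hL := level_card eta0.
have h1 : eps * (n%:R / 2) <= lam ^+ 2 * x v.
  by rewrite mulrC; apply: ler_pM; rewrite ?divr_ge0 // ltW.
suff : C%:R * #|level eta|%:R <= eps * n%:R / 8.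
  by move: h h1; rewrite mulrA etaC; lra.
have lam_eta : 8 * C%:R ^+ 2 <= eps * (lam * eta).
  have -> : eps * (lam * eta) = eps ^+ 2 * lam / (8 * C%:R).
    by rewrite /eta; field; rewrite gt_eqF //; lra.
  by rewrite ler_pdivlMr; [move: lam_big; lra | lra].
have : #|level eta|%:R * (8 * C%:R ^+ 2) <= eps * (C%:R * n%:R).
  apply: (@le_trans _ _ (#|level eta|%:R * (eps * (lam * eta)))); first exact: ler_wpM2l.
  by rewrite mulrCA ler_wpM2l // ltW.
move=> h2; rewrite -(ler_pM2l (_ : 0 < 8 * C%:R)); last by lra.
by move: h2; lra.
Qed.

(** Large vertices have linear degree while all degrees sum to at most [C n], so there are at most
    [4 C^2 / eps] of them, whatever [n] is. *)
Lemma level_card_bounded : (#|level eps| <= K)%N.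
Proof.
have c1 := C1; have t1 := t1R; have n1 := nR; have e1 := eps_half.
have h := @level_deg_sum eps (eps * n%:R / 4 / C%:R).
have {h} : #|level eps|%:R * (eps * n%:R / 4 / C%:R) <= C%:R * n%:R.
  apply: h; first by rewrite !divr_ge0 ?mulr_ge0 // ltW.
  move=> v /level_degree hv; rewrite ler_pdivrMr; last by lra.
  by rewrite [leRHS]mulrC.
have -> : #|level eps|%:R * (eps * n%:R / 4 / C%:R) = (eps * #|level eps|%:R) * (n%:R / (4 * C%:R)).
  by field; rewrite gt_eqF //; lra.
rewrite -ler_pdivlMr; last by rewrite divr_gt0 // mulr_gt0 //; lra.
have -> : C%:R * n%:R / (n%:R / (4 * C%:R)) = 4 * C%:R ^+ 2 :> R.
  by field; rewrite !gt_eqF //; lra.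
move=> h; rewrite -(ler_nat R) -(ler_pM2l eps_gt0).
exact: le_trans h K_big.
Qed.

Local Notation L := (level eps).
Definition bad := [set w | (t < #|N w :&: L|)%N].

(** A bad vertex is a common neighbour of some [t + 1] large vertices; there are at most [2 ^ K]
    such sets, each with fewer than [r] common neighbours. *)
Lemma bad_card : (#|bad| <= r * 2 ^ K)%N.
Proof.
pose X := [set T : {set G} | T \subset L & #|T| == t.+1].
have sub : bad \subset \bigcup_(T in X) common T.
  apply/subsetP => w; rewrite inE => tw.
  have [T /subsetP TN cT] : exists2 T : {set G}, T \subset N w :&: L & #|T| = t.+1.
    case: (@card_geqP _ (mem (N w :&: L)) t.+1 tw) => s [us ss sL].
    exists [set y in s]; last by rewrite cardsE (card_uniqP us).
    by apply/subsetP => y; rewrite inE => /sL.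
  apply/bigcupP; exists T.
    rewrite inE cT eqxx andbT; apply/subsetP => y /TN; rewrite inE; by case/andP.
  rewrite inE; apply/forall_inP => y /TN; rewrite inE in_N adj_sym; by case/andP.
apply: leq_trans (subset_leq_card sub) _.
apply: (@leq_trans (\sum_(T in X) r)).
  apply: leq_trans (leq_card_bigcup _ _) _; apply: leq_sum => T.
  by rewrite inE => /andP[_ /eqP /few_common /ltnW].
rewrite sum_nat_const mulnC leq_mul2l; apply/orP; right.
apply: (@leq_trans #|powerset L|).
  by apply: subset_leq_card; apply/subsetP => T; rewrite !inE => /andP[].
by rewrite card_powerset leq_exp2l // level_card_bounded.
Qed.

Lemma bad_sum (A : {set G}) :
  \sum_(w in A :&: bad) \sum_(y in N w :&: L) x y <= M%:R.
Proof.
apply: (@le_trans _ _ (\sum_(w in A :&: bad) K%:R)).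
  apply: ler_sum => w _; apply: le_trans (sum_le_card _) _; rewrite ler_nat.
  apply: leq_trans level_card_bounded; exact: subset_leq_card (subsetIr _ _).
rewrite sumr_const -[leLHS]mulr_natr -natrM ler_nat; apply: leq_trans M_big.
rewrite leq_mul2l; apply/orP; right; apply: leq_trans bad_card; exact: subset_leq_card (subsetIr _ _).
Qed.

Lemma good_sum w : w \notin bad -> \sum_(y in N w :&: L) x y <= t%:R.
Proof.
rewrite inE -leqNgt => le; apply: le_trans (sum_le_card _) _.
by rewrite ler_nat.
Qed.

(** Applied with [s = t] to bound degrees, and with [s] slightly below [t] to find a good neighbour
    of the maximum. *)
Lemma two_step_good v (s : R) : 0 <= s ->
  (forall w, adj G v w -> w \notin bad -> \sum_(y in N w :&: L) x y <= s) ->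
  lam ^+ 2 * x v <= eps * (C%:R * n%:R) + s * #|N v|%:R + M%:R.
Proof.
move=> s0 h; apply: le_trans (two_step v (ltW eps_gt0)) _.
rewrite -addrA lerD2l (big_setID bad) /= addrC; apply: lerD; last exact: bad_sum.
apply: (@le_trans _ _ (\sum_(w in N v :\: bad) s)).
  by apply: ler_sum => w /setDP[]; rewrite in_N; exact: h.
rewrite sumr_const -[leLHS]mulr_natr ler_wpM2l // ler_nat.
exact: subset_leq_card (subsetDl _ _).
Qed.

(** [two_step_good] with [s = t] is compared with [lam ^ 2 >= t (n - t)] and divided by [t]. *)
Lemma degree_ge v : x v * n%:R - 2 * C%:R * eps * n%:R <= #|N v|%:R.
Proof.
have c1 := C1; have t1 := t1R; have n1 := nR; have e1 := eps_half.
have h := @two_step_good v t%:R (ler0n _ _) (fun w _ => @good_sum w).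
have h1 : t%:R * (n%:R - t%:R) * x v <= lam ^+ 2 * x v by rewrite ler_wpM2r.
have tx : t%:R ^+ 2 * x v <= t%:R ^+ 2 by rewrite ler_piMr // exprn_ge0.
have en : eps * n%:R <= eps * (C%:R * n%:R).
  by rewrite ler_wpM2l ?ler_peMl // ltW.
have r0 : 0 <= r%:R :> R by [].
have h2 : t%:R * (x v * n%:R) <= 2 * (eps * (C%:R * n%:R)) + t%:R * #|N v|%:R.
  move: h1 h tx en n_bigR; rewrite !mulrBr !mulrBl; nra.
have h3 : 2 * (eps * (C%:R * n%:R)) <= t%:R * (2 * C%:R * eps * n%:R).
  have -> : 2 * (eps * (C%:R * n%:R)) = 2 * C%:R * eps * n%:R by ring.
  by rewrite ler_peMl // !mulr_ge0 // ltW.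
rewrite -(ler_pM2l (_ : 0 < t%:R)); last by lra.
rewrite mulrBr; lra.
Qed.

(** Some good neighbour [w] of [u] sees large entries of total nearly [t]. There are at most [t] of
    them, each at most 1, so exactly [t], all near 1; by [degree_ge] they miss few vertices. A
    vertex outside [T] has fewer than [r] neighbours in [common T], so its degree and its entry are
    small. *)
Lemma high_degree_vertices (u : G) : x u = 1 ->
  exists T : {set G}, [/\ #|T| = t,
    forall y, y \in T -> 1 - 2 * C%:R * eps <= x y,
    n%:R - #|common T|%:R <= 4 * C%:R * eps * t%:R * n%:R &
    forall v, v \notin T -> x v <= 8 * C%:R * t.+1%:R * eps].
Proof.
have c1 := C1; have t1 := t1R; have n1 := nR; have e1 := eps_half.
move=> xu.
have [w [uw wg sw]] : exists w, [/\ adj G u w, w \notin bad &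
    t%:R - 2 * C%:R * eps <= \sum_(y in N w :&: L) x y].
  case: (boolP [exists w, [&& adj G u w, w \notin bad &
      t%:R - 2 * C%:R * eps <= \sum_(y in N w :&: L) x y]]).
    by move=> /existsP [w /and3P[? ? ?]]; exists w.
  (* Otherwise [two_step_good] at [u] with [s = t - 2 C eps] gives [lam ^ 2 <= t n - C eps n + M],
     below [t (n - t)] by [n_big]. *)
  rewrite negb_exists => /forallP no.
  have s0 : 0 <= t%:R - 2 * C%:R * eps by rewrite subr_ge0 (le_trans (ltW eps_small)).
  have := @two_step_good u _ s0; rewrite xu mulr1 => hu.
  have {}hu : lam ^+ 2 <= eps * (C%:R * n%:R) +
      (t%:R - 2 * C%:R * eps) * #|N u|%:R + M%:R.
    apply: hu => w uw wg; apply: ltW; have := no w.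
    by rewrite uw wg /= -ltNge.
  have dn : (t%:R - 2 * C%:R * eps) * #|N u|%:R <= (t%:R - 2 * C%:R * eps) * n%:R.
    by rewrite ler_wpM2l // ler_nat max_card.
  have en : eps * n%:R <= eps * (C%:R * n%:R).
    by rewrite ler_wpM2l ?ler_peMl // ltW.
  have r0 : 0 <= r%:R :> R by [].
  move: hu dn lam_sq en n_bigR; rewrite !mulrBr !mulrBl.
  by have -> : 2 * C%:R * eps * n%:R = 2 * (eps * (C%:R * n%:R)) by [ring]; lra.
pose T := N w :&: L; exists T.
have cT : #|T| = t.
  apply/eqP; rewrite eqn_leq; apply/andP; split; first by move: wg; rewrite inE -leqNgt.
  rewrite leqNgt; apply/negP => lt.
  have : #|T|%:R <= t%:R - 1 :> R.
    by rewrite lerBrDr natr1 ler_nat.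
  move=> hT; have h4 := le_trans sw (sum_le_card T).
  have h (a b c : R) : a - b <= c -> c <= a - 1 -> b < 1 -> False by move=> *; lra.
  exact: h h4 hT eps_small.
have xT y : y \in T -> 1 - 2 * C%:R * eps <= x y.
  move=> yT; move: sw; rewrite -/T (big_setD1 y yT) /= => sw.
  have := sum_le_card (T :\ y).
  have tE : t%:R = 1 + #|T :\ y|%:R :> R by rewrite -cT (cardsD1 y T) yT natrD.
  by rewrite tE in sw => h; lra.
have cB : n%:R - #|common T|%:R <= 4 * C%:R * eps * t%:R * n%:R.
  rewrite -[X in X%:R - _ <= _](cardsC (common T)) natrD addrAC subrr add0r.
  have sub : ~: common T \subset \bigcup_(y in T) ~: N y.
    apply/subsetP => v; rewrite !inE => /forall_inPn [y yT yv].
    by apply/bigcupP; exists y; rewrite // !inE.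
  apply: (@le_trans _ _ (\sum_(y in T) #|~: N y|%:R)).
    rewrite -natr_sum ler_nat; apply: leq_trans (subset_leq_card sub) _.
    exact: leq_card_bigcup.
  have -> : 4 * C%:R * eps * t%:R * n%:R = \sum_(y in T) (4 * C%:R * eps * n%:R).
    by rewrite sumr_const cT -[RHS]mulr_natr mulrAC.
  apply: ler_sum => y /xT xy.
  have hd := degree_ge y.
  have nE : #|~: N y|%:R = n%:R - #|N y|%:R :> R by rewrite -(cardsC (N y)) natrD addrAC subrr add0r.
  have hx : (1 - 2 * C%:R * eps) * n%:R <= x y * n%:R by rewrite ler_wpM2r.
  by move: hd hx; rewrite nE mulrBl mul1r; lra.
split=> // v vT.
have hv : (#|N v :&: common T| < r)%N.
  have -> : N v :&: common T = nbrs (common T) v by apply/setP => z; rewrite !inE andbC.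
  by rewrite -common_setU1; apply: few_common; rewrite cardsU1 vT cT.
have dv : #|N v|%:R <= r%:R + (n%:R - #|common T|%:R) :> R.
  rewrite -[X in _ <= _ + (X%:R - _)](cardsC (common T)) natrD addrAC subrr add0r -natrD ler_nat.
  rewrite -(cardsID (common T) (N v)); apply: leq_add; first exact: ltnW.
  by apply: subset_leq_card; apply/subsetP => z; rewrite !inE => /andP[].
have h := degree_ge v.
have rn : r%:R <= eps * n%:R.
  have : 0 <= M%:R :> R by [].
  have : 0 <= t%:R ^+ 2 :> R by rewrite exprn_ge0.
  by move: n_bigR; lra.
rewrite -(ler_pM2r nR) -natr1.
have e3 : eps * n%:R <= C%:R * (eps * n%:R) by rewrite ler_peMl // mulr_ge0 // ltW.
have e2 : 0 <= C%:R * eps * t%:R * n%:R by rewrite !mulr_ge0 // ltW.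
have : x v * n%:R <= 2 * C%:R * eps * n%:R + eps * n%:R + 4 * C%:R * eps * t%:R * n%:R by lra.
have : 0 <= C%:R * eps * n%:R by rewrite !mulr_ge0 // ltW.
lra.
Qed.

End HighDegree.

(** * Comparison with the extremal graph *)

Section CompareForms.
Variables (R : realFieldType) (G : sgraph) (r C : nat) (x : G -> R).
Variables (T : {set G}) (f : rel G) (e : R).
Hypothesis sparse : forall W : {set G}, (degsum W <= C * #|W|)%N.
Hypothesis x0 : forall v, 0 <= x v.
Hypothesis few_nbrs : forall v, v \notin T -> (#|nbrs (common T) v| <= r)%N.
Hypothesis x_small : forall v, v \notin T -> x v <= e.
Hypothesis x_large : forall v, v \in T -> 1 / 2 <= x v.
Hypothesis e_small : (r%:R + 2 * C%:R) * e <= 1 / 4.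
Hypothesis f_sym : symmetric f.
Hypothesis f_dom : forall v w, v \in T -> w != v -> f v w.
Hypothesis f_common : forall v w, v \in common T -> w \in common T -> adj G v w -> f v w.

Definition qform (g : rel G) (A B : {set G}) : R :=
  \sum_(v in A) \sum_(w in B) (g v w)%:R * (x v * x w).

(** Brings all forms to sums over the same pairs, for a pairwise comparison. *)
Lemma qform_indicator (g : rel G) (A B : {set G}) :
  \sum_v \sum_w [&& v \in A, w \in B & g v w]%:R * (x v * x w) = qform g A B.
Proof.
rewrite /qform [RHS]big_mkcond; apply: eq_bigr => v _.
case: (v \in A) => /=; last by rewrite big1 // => w _; rewrite mul0r.
rewrite [RHS]big_mkcond; apply: eq_bigr => w _.
by case: (w \in B); rewrite //= mul0r.
Qed.

Lemma qform_le_nbrs (A : {set G}) v : (forall w, w \in A -> w \notin T) ->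
  \sum_(w in A) (adj G v w)%:R * (x v * x w) <= #|nbrs A v|%:R * e * x v.
Proof.
move=> AT; rewrite -mulrA mulr_natl -sumr_const [leRHS]big_mkcond [leLHS]big_mkcond /=.
apply: ler_sum => w _; rewrite inE; case: (boolP (w \in A)) => //= wA.
case: adj; rewrite ?mul0r // mul1r mulrC ler_wpM2r // x_small // AT //.
Qed.

(** Sparsity gives a vertex [v] of degree at most [C] in [W]; removing it costs at most [2 C e x_v],
    and the rest follows by induction. *)
Lemma qform_sparse (W : {set G}) : (forall w, w \in W -> w \notin T) -> 0 <= e ->
  qform (adj G) W W <= 2 * C%:R * e * \sum_(v in W) x v.
Proof.
move=> WT e0; have [m] := ubnP #|W|; elim: m W WT => // m IH W WT; rewrite ltnS => Wm.
case: (W =P set0) => [->|/eqP W0]; first by rewrite /qform !big_set0 mulr0.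
have [v vW vC] : exists2 v, v \in W & (#|nbrs W v| <= C)%N.
  apply/exists_inP; apply: contraT; rewrite negb_exists_in => /forall_inP no.
  have := sparse W; rewrite leqNgt; case/negP.
  apply: leq_trans (_ : C.+1 * #|W| <= _)%N.
    by rewrite mulSn -[X in (X < _)%N]add0n ltn_add2r card_gt0.
  by apply: degsum_nbrs_ge => w wW; rewrite ltnNge no.
have cW : (#|W :\ v| < m)%N by move: Wm; rewrite (cardsD1 v W) vW.
have WT' w : w \in W :\ v -> w \notin T by move=> /setD1P[_ /WT].
have h := IH _ WT' cW.
have hv := qform_le_nbrs v WT'.
have hc : #|nbrs (W :\ v) v|%:R * e * x v <= C%:R * e * x v.
  rewrite ler_wpM2r // ler_wpM2r // ler_nat; apply: leq_trans vC.
  by apply: subset_leq_card; apply/subsetP => w; rewrite !inE => /andP[/andP[_ ->] ->].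
have -> : qform (adj G) W W = qform (adj G) (W :\ v) (W :\ v) +
    2 * \sum_(w in W :\ v) (adj G v w)%:R * (x v * x w).
  rewrite /qform (big_setD1 v) //= (big_setD1 v (A := W)) //= adj_irr mul0r add0r.
  rewrite [X in _ + X = _](eq_bigr (fun u => (adj G v u)%:R * (x v * x u) +
      \sum_(w in W :\ v) (adj G u w)%:R * (x u * x w))) => [|u _].
    by rewrite big_split /=; ring.
  by rewrite (big_setD1 v) //= adj_sym [x u * x v]mulrC.
have -> : \sum_(w in W) x w = x v + \sum_(w in W :\ v) x w by exact: big_setD1.
have h' := le_trans hv hc; rewrite mulrDr.
rewrite addrC; apply: lerD h.
have -> : 2 * C%:R * e * x v = 2 * (C%:R * e * x v) by rewrite !mulrA.
by rewrite ler_pM2l.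
Qed.

Definition rest := ~: (T :|: common T).

Lemma rest_notin v : v \in rest -> v \notin T.
Proof. by rewrite !inE negb_or => /andP[]. Qed.

Lemma e_ge0 v : v \in rest -> 0 <= e.
Proof. by move=> /rest_notin /x_small; apply: le_trans. Qed.

(** Each vertex of [rest] has at most [r] neighbours in [common T], with entries at most [e], and
    [qform_sparse] handles the edges inside [rest]. *)
Lemma rest_loss : qform (adj G) rest (~: T) <= 1 / 4 * \sum_(v in rest) x v.
Proof.
case: (set_0Vmem rest) => [r0|[v0 v0r]]; first by rewrite /qform r0 !big_set0 mulr0.
have e0 := e_ge0 v0r.
have -> : qform (adj G) rest (~: T) = qform (adj G) rest (common T) + qform (adj G) rest rest.
  rewrite /qform -big_split /=; apply: eq_bigr => v _.
  rewrite (big_setID (common T)) /=; congr (_ + _); apply: eq_bigl => w.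
    rewrite !inE andbC; case: (boolP [forall z in T, adj G z w]) => //= h.
    by apply: common_disj; rewrite inE.
  by rewrite !inE negb_or andbC.
have h1 : qform (adj G) rest (common T) <= r%:R * e * \sum_(v in rest) x v.
  rewrite mulr_sumr; apply: ler_sum => v /rest_notin vT.
  apply: le_trans (qform_le_nbrs v (@common_disj _ _)) _.
  by rewrite ler_wpM2r // ler_wpM2r // ler_nat few_nbrs.
have h2 := qform_sparse rest_notin e0.
have h3 : (r%:R + 2 * C%:R) * e * (\sum_(v in rest) x v) <= 1 / 4 * \sum_(v in rest) x v.
  by rewrite ler_wpM2r // sumr_ge0.
by apply: le_trans h3; rewrite (mulrDl r%:R) mulrDl; apply: lerD.
Qed.

(** A vertex of [rest] misses some vertex of [T], whose entry is at least 1/2. *)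
Lemma rest_gain : 1 / 2 * \sum_(v in rest) x v <= qform (fun v w => ~~ adj G v w) rest T.
Proof.
rewrite mulr_sumr; apply: ler_sum => v vr.
have [w wT vw] : exists2 w, w \in T & ~~ adj G v w.
  move: vr; rewrite !inE negb_or => /andP[_ /forall_inPn [w wT]].
  by rewrite adj_sym; exists w.
rewrite (big_setD1 w wT) /= vw !mul1r -[leLHS]addr0; apply: lerD.
  by rewrite [leRHS]mulrC ler_wpM2r // -div1r x_large.
by apply: sumr_ge0 => u _; rewrite !mulr_ge0.
Qed.

Lemma compare_forms :
  qform (adj G) setT setT + 1 / 2 * \sum_(v in rest) x v <= qform f setT setT.
Proof.
pose na v w := ~~ adj G v w.
have swap (g : rel G) (A B : {set G}) : symmetric g -> qform g A B =
    \sum_v \sum_w [&& w \in A, v \in B & g v w]%:R * (x v * x w).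
  move=> gs; rewrite -qform_indicator exchange_big; apply: eq_bigr => v _.
  by apply: eq_bigr => w _; rewrite gs [x w * _]mulrC.
have na_sym : symmetric na by move=> v w; rewrite /na adj_sym.
(* Both orders of a pair count, whence the surplus [2 (1/2 - 1/4)]. The inequality left holds for
   each ordered pair separately, by a Boolean case check. *)
suff : qform (adj G) setT setT + (qform na rest T + qform na rest T) <=
    qform f setT setT + (qform (adj G) rest (~: T) + qform (adj G) rest (~: T)).
  by have := rest_gain; have := rest_loss; rewrite -/na; lra.
rewrite [X in _ + (_ + X) <= _](swap na rest T na_sym).
rewrite [X in _ <= _ + (_ + X)](swap (adj G) rest (~: T) (@adj_sym G)).
rewrite -!qform_indicator -!big_split /=; apply: ler_sum => v _.
rewrite -!big_split /=; apply: ler_sum => w _.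
rewrite -!mulrDl; apply: ler_wpM2r; first by rewrite mulr_ge0.
rewrite -!natrD ler_nat !in_setT /= /na.
have irr : adj G v w -> w != v by apply: contraTneq => ->; rewrite adj_irr.
have dv := @f_dom v w; have dw := @f_dom w v; have fc := @f_common v w.
have tv : v \in T -> v \notin common T by move=> h; apply/negP => /common_disj; rewrite h.
have tw : w \in T -> w \notin common T by move=> h; apply/negP => /common_disj; rewrite h.
have vw : (v \in T) != (w \in T) -> w != v by apply: contraNneq => ->.
move: irr dv dw fc tv tw vw; rewrite /rest !in_setC !in_setU (f_sym w v) (eq_sym v w).
case: (v \in T); case: (w \in T); case: (v \in common T); case: (w \in common T);
case: (adj G v w); case: (w != v); case: (f v w) => //= *;
repeat match goal with
| h : is_true true -> _ |- _ => specialize (h isT)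
| h : is_true false |- _ => discriminate h end.
Qed.

End CompareForms.

Lemma qform_adj (G : sgraph) (x : G -> algR) :
  qform x (adj G) setT setT = \sum_v (\sum_(w | adj G v w) x w) * x v.
Proof.
rewrite /qform (eq_bigl xpredT) => [|v]; last by rewrite inE.
apply: eq_bigr => v _; rewrite mulr_suml [RHS]big_mkcond /=.
rewrite (eq_bigl xpredT) => [|w]; last by rewrite inE.
by apply: eq_bigr => w _; case: adj; rewrite ?mul0r // mul1r mulrC.
Qed.

Lemma qform_subset_le (R : realFieldType) (G : sgraph) (x : G -> R) (g : rel G)
    (A B : {set G}) : (forall v, 0 <= x v) ->
  qform x g A B + qform x g (~: A) (~: B) <= qform x g setT setT.
Proof.
move=> x0; rewrite -!qform_indicator -big_split; apply: ler_sum => v _.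
rewrite -big_split; apply: ler_sum => w _ /=.
rewrite -mulrDl ler_wpM2r ?mulr_ge0 // -natrD ler_nat !inE.
by case: (v \in A); case: (w \in B); case: g.
Qed.

(* Rayleigh quotient of the vector equal to [lamR F] on [U] and to [t]
   elsewhere; the optimal vector would need square roots. *)
Lemma lamR_dominating_ge (F : sgraph) (U : {set F}) :
  (forall u w, u \in U -> w != u -> adj F u w) ->
  #|U|%:R * (#|F|%:R - #|U|%:R) <= lamR F ^+ 2.
Proof.
move=> dom; set t := #|U|; set l := lamR F.
have l0 : 0 <= l := lamR_ge0 F.
have cE : #|F|%:R - t%:R = #|~: U|%:R :> algR by rewrite -(cardsC U) natrD addrAC subrr add0r.
rewrite cE; set s := #|~: U|.
have key (a b : algR) : 0 <= a -> 0 <= b ->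
    2 * (t%:R * s%:R * (a * b)) <= l * (t%:R * a ^+ 2 + s%:R * b ^+ 2).
  move=> a0 b0; pose y v := if v \in U then a else b.
  have y0 v : 0 <= y v by rewrite /y; case: ifP.
  have [le _] := rayleigh y.
  have nE : \sum_v y v ^+ 2 = t%:R * a ^+ 2 + s%:R * b ^+ 2.
    rewrite (bigID (mem U)) /=; congr (_ + _).
      rewrite (eq_bigr (fun=> a ^+ 2)) => [|v vU]; last by rewrite /y vU.
      by rewrite sumr_const mulr_natl.
    rewrite (eq_bigr (fun=> b ^+ 2)) => [|v /negbTE vU]; last by rewrite /y vU.
    rewrite (eq_bigl (mem (~: U))) => [|v]; last by rewrite !inE.
    by rewrite sumr_const mulr_natl.
  rewrite nE -qform_adj in le; apply: le_trans le.
  apply: le_trans (qform_subset_le (adj F) U (~: U) y0).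
  rewrite setCK; have -> : qform y (adj F) U (~: U) = t%:R * s%:R * (a * b).
    rewrite /qform (eq_bigr (fun=> s%:R * (a * b))) => [|v vU].
      by rewrite sumr_const -[LHS]mulr_natl mulrA.
    rewrite (eq_bigr (fun=> a * b)) => [|w]; first by rewrite sumr_const mulr_natl.
    rewrite inE => wU; rewrite /y vU (negbTE wU) dom // ?mul1r //.
    by apply: contraNneq wU => ->.
  have -> : qform y (adj F) (~: U) U = t%:R * s%:R * (a * b).
    rewrite /qform exchange_big (eq_bigr (fun=> s%:R * (a * b))) => [|v vU].
      by rewrite sumr_const -[LHS]mulr_natl mulrA.
    rewrite (eq_bigr (fun=> a * b)) => [|w]; first by rewrite sumr_const mulr_natl.
    rewrite inE => wU; rewrite /y vU (negbTE wU) adj_sym dom // ?mul1r 1?mulrC //.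
    by apply: contraNneq wU => ->.
  by lra.
have [ts0|ts0] := posnP (t * s)%N.
  by rewrite -natrM ts0 exprn_ge0.
have tsR : 0 < t%:R * s%:R :> algR by rewrite -natrM ltr0n.
have tR : 0 < t%:R :> algR by rewrite ltr0n; move: ts0; rewrite muln_gt0 => /andP[].
(* [key] at [a = b = 1] excludes [l = 0], so [l * t] can be cancelled below. *)
have lp : 0 < l.
  rewrite lt_neqAle l0 andbT; apply/eqP => e.
  have := key 1 1 ler01 ler01; rewrite -e mul0r !mulr1; lra.
have := key l t%:R l0 (ltW tR).
have -> : 2 * (t%:R * s%:R * (l * t%:R)) = (l * t%:R) * (2 * (t%:R * s%:R)) by ring.
have -> : l * (t%:R * l ^+ 2 + s%:R * t%:R ^+ 2) = (l * t%:R) * (l ^+ 2 + t%:R * s%:R) by ring.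
rewrite ler_pM2l ?mulr_gt0 //; lra.
Qed.

(** * From quadratic forms to spectral radii, with equality *)

Section SpectralCompare.
Variables (G F : sgraph) (r C : nat) (x : G -> algR) (T : {set G}) (e : algR).
Variables (g : F -> G).
Hypothesis g_bij : bijective g.
Hypothesis sparse : forall W : {set G}, (degsum W <= C * #|W|)%N.
Hypothesis x0 : forall v, 0 <= x v.
Hypothesis eigen : forall v, \sum_(w | adj G v w) x w = lamR G * x v.
Hypothesis few_nbrs : forall v, v \notin T -> (#|nbrs (common T) v| <= r)%N.
Hypothesis x_small : forall v, v \notin T -> x v <= e.
Hypothesis x_large : forall v, v \in T -> 1 / 2 <= x v.
Hypothesis e_small : (r%:R + 2 * C%:R) * e <= 1 / 4.
Hypothesis T0 : T != set0.
Hypothesis F_dom : forall a b, g a \in T -> b != a -> adj F a b.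
Hypothesis F_common : forall a b, g a \in common T -> g b \in common T ->
  adj G (g a) (g b) -> adj F a b.

Lemma spectral_compare :
  lamR G <= lamR F /\ (lamR G = lamR F -> isomorphic G F).
Proof.
have [g' gK g'K] := g_bij.
pose f v w := adj F (g' v) (g' w).
have f_sym : symmetric f by move=> v w; rewrite /f adj_sym.
have f_dom v w : v \in T -> w != v -> f v w.
  by move=> vT wv; apply: F_dom; rewrite ?g'K // (can_eq g'K).
have f_common v w : v \in common T -> w \in common T -> adj G v w -> f v w.
  by move=> vB wB vw; apply: F_common; rewrite ?g'K.
have cmp := compare_forms sparse x0 few_nbrs x_small x_large e_small f_sym f_dom f_common.
pose y := x \o g.
have qF : qform x f setT setT = \sum_a (\sum_(b | adj F a b) y b) * y a.
  rewrite -qform_adj /qform (eq_bigl xpredT) => [|v]; last by rewrite inE.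
  rewrite [RHS](eq_bigl xpredT) => [|v]; last by rewrite inE.
  rewrite (reindex _ (onW_bij _ g_bij)) //=; apply: eq_bigr => a _.
  rewrite (eq_bigl xpredT) => [|v]; last by rewrite inE.
  rewrite [RHS](eq_bigl xpredT) => [|v]; last by rewrite inE.
  by rewrite (reindex _ (onW_bij _ g_bij)) //=; apply: eq_bigr => b _; rewrite /f !gK.
have nF : \sum_v x v ^+ 2 = \sum_a y a ^+ 2 by rewrite (reindex _ (onW_bij _ g_bij)).
have qG : qform x (adj G) setT setT = lamR G * \sum_v x v ^+ 2.
  rewrite qform_adj mulr_sumr; apply: eq_bigr => v _.
  by rewrite eigen expr2 -mulrA.
have [t tT] := set0Pn _ T0.
have xT v : v \in T -> 0 < x v by move=> /x_large; apply: lt_le_trans; rewrite divr_gt0.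
have xt := xT t tT.
have norm_gt0 : 0 < \sum_v x v ^+ 2.
  rewrite (bigD1 t) //=; apply: (@lt_le_trans _ _ (x t ^+ 2)); first exact: exprn_gt0.
  by rewrite lerDl; apply: sumr_ge0 => v _; apply: exprn_ge0.
have rest0 : 0 <= 1 / 2 * \sum_(v in rest T) x v.
  by rewrite mulr_ge0 ?divr_ge0 // sumr_ge0.
have [le eq] := rayleigh y; rewrite -qF -nF in le eq; rewrite qG in cmp.
have leGF : lamR G * (\sum_v x v ^+ 2) <= lamR F * (\sum_v x v ^+ 2) by lra.
split; first by rewrite ler_pM2r in leGF.
move=> lGF; rewrite lGF in cmp qG.
have qeq : qform x f setT setT = lamR F * \sum_v x v ^+ 2.
  by apply/eqP; rewrite eq_le le /=; lra.
have eF := eq qeq.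
(* In the equality case [x] is an eigenvector for [F], where every vertex is adjacent to [t]; a zero
   entry would force [x t <= 0]. *)
have x_gt0 v : 0 < x v.
  case: (boolP (v \in T)) => vT; first exact: xT.
  rewrite lt_neqAle x0 andbT; apply: contraTneq xt => xv0; rewrite -leNgt.
  have := eF (g' v); rewrite /y /= g'K -xv0 mulr0 => <-.
  rewrite (bigD1 (g' t)) /=; last first.
    by rewrite adj_sym; apply: f_dom => //; apply: contraNneq vT => ->.
  by rewrite g'K lerDl sumr_ge0.
have rest_empty : rest T = set0.
  apply/eqP; apply: contraT => /set0Pn [v vr].
  have : 0 < \sum_(w in rest T) x w.
    rewrite (bigD1 v) //=; apply: (@lt_le_trans _ _ (x v)) => //.
    by rewrite lerDl sumr_ge0.
  by rewrite qeq in cmp; lra.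
have adj_sub v w : adj G v w -> f v w.
  move=> vw; have wv : w != v by apply: contraTneq vw => ->; rewrite adj_irr.
  have mem z : z \notin T -> z \in common T.
    move=> zT; have : z \notin rest T by rewrite rest_empty inE.
    by rewrite in_setC negbK in_setU (negbTE zT).
  case: (boolP (v \in T)) => vT; first exact: f_dom.
  case: (boolP (w \in T)) => wT; first by rewrite f_sym; apply: f_dom; rewrite // eq_sym.
  by apply: f_common; rewrite // mem.
(* By positivity of [x], an additional edge of [F] would strictly increase the form. *)
have fE v w : f v w = adj G v w.
  apply/idP/idP; last exact: adj_sub.
  apply: contraTT => nvw; apply/negP => fvw.
  have le_term a b : (adj G a b)%:R * (x a * x b) <= (f a b)%:R * (x a * x b).
    by rewrite ler_wpM2r ?mulr_ge0 // ler_nat; case ab: adj => //; rewrite adj_sub.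
  have : qform x (adj G) setT setT < qform x f setT setT.
    rewrite /qform (bigD1 v) ?inE //= [ltRHS](bigD1 v) ?inE //=; apply: ltr_leD; last first.
      by apply: ler_sum => a _; apply: ler_sum => b _.
    rewrite (bigD1 w) ?inE //= [ltRHS](bigD1 w) ?inE //=; apply: ltr_leD; last exact: ler_sum.
    by rewrite fvw (negbTE nvw) mul0r mul1r mulr_gt0.
  by rewrite qG qeq ltxx.
exists g'; split; first by exists g.
by move=> v w; rewrite -fE.
Qed.

End SpectralCompare.

Theorem extremal_compare (r t C : nat) : (0 < t)%N -> (0 < C)%N ->
  exists n0 : nat, forall G F : sgraph, (n0 <= #|G|)%N -> #|F| = #|G| ->
    (forall W : {set G}, degsum W <= C * #|W|)%N ->
    (forall T : {set G}, #|T| = t.+1 -> #|common T| < r)%N ->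
    (exists2 U : {set F}, #|U| = t & forall u w, u \in U -> w != u -> adj F u w) ->
    (forall T : {set G}, #|T| = t -> (r <= #|common T|)%N ->
      exists g : F -> G, [/\ bijective g,
        forall a b, g a \in T -> b != a -> adj F a b &
        forall a b, g a \in common T -> g b \in common T ->
          adj G (g a) (g b) -> adj F a b]) ->
  lamR G <= lamR F /\ (lamR G = lamR F -> isomorphic G F).
Proof.
have split3 (a b c d m : nat) : (a + b + c + d < m)%N ->
    [/\ (a <= m)%N, (b + c <= m)%N & (d <= m)%N] by move=> h; split; lia.
move=> t0 C0.
(* [eps = 1 / E] is chosen so that the bound [8 C (t + 1) eps] on entries outside [T] meets
   [e_small] with equality; likewise [K] gives [eps K = 4 C^2] and [Q] gives [eps^2 Q = 64 C^3]. *)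
pose E := (32 * C * t.+1 * (r + 2 * C))%N.
pose K := (4 * C ^ 2 * E)%N; pose M := (K * (r * 2 ^ K))%N.
pose Q := (64 * C ^ 3 * E ^ 2)%N.
(* The summands serve in turn [n_big], the bound [Q <= lamR G], and [r <= #|common T|]. *)
exists (E * (t ^ 2 + M + r + 1) + Q ^ 2 + t + 2 * r).+1%N => G F nG cF sparse few [U cU U_dom] emb.
set n := #|G| in nG cF *; have [n1 n2 n3] := split3 _ _ _ _ _ nG.
have lF := lamR_dominating_ge U_dom; rewrite cU cF in lF.
(* Below this value [G] already loses strictly to [F]; above it the hypothesis [lam_sq] is
   available. *)
have [ltG|geG] := ltP (lamR G ^+ 2) (t%:R * (n%:R - t%:R)).
  have : lamR G < lamR F.
    by rewrite -(ltr_sqr (lamR_ge0 G) (lamR_ge0 F)); apply: lt_le_trans lF.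
  by move=> lt; split=> [|e]; [exact: ltW | rewrite e ltxx in lt].
have n0 : (0 < n)%N by apply: leq_trans nG.
have E0 : (0 < E)%N by rewrite !muln_gt0 addn_gt0 C0 /= muln_gt0 C0 orbT.
have ER : 0 < E%:R :> algR by rewrite ltr0n.
pose eps : algR := E%:R^-1.
have eps0 : 0 < eps by rewrite invr_gt0.
have epsE (m : algR) : m * eps * E%:R = m by rewrite /eps mulfVK // gt_eqF.
have CR : 1 <= C%:R :> algR by rewrite ler1n.
have tR : 1 <= t%:R :> algR by rewrite ler1n.
have rR : 0 <= r%:R :> algR by [].
have [x [x0 x1 [u xu] eigen]] := perron n0.
have ERE : E%:R = 32 * C%:R * (t%:R + 1) * (r%:R + 2 * C%:R) :> algR.
  by rewrite /E !natrM natrD natrM -[t.+1%:R]natr1.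
have eq_e : 8 * C%:R * t.+1%:R * eps * (r%:R + 2 * C%:R) = 1 / 4.
  rewrite /eps ERE -[t.+1%:R]natr1; field; rewrite !gt_eqF //=; nra.
have small : 8 * C%:R * t.+1%:R * eps <= 1 / 4.
  have eps0' := ltW eps0.
  by rewrite -eq_e ler_peMr ?mulr_ge0 //; lra.
have t_small : 4 * C%:R * eps * t%:R <= 1 / 8.
  have : 0 < C%:R * eps by apply: mulr_gt0 => //; lra.
  by move: small; rewrite -[t.+1%:R]natr1; lra.
have c_small : 4 * C%:R * eps <= 1 / 8.
  by apply: le_trans t_small; rewrite ler_peMr // !mulr_ge0 // ltW.
have lam_ge : Q%:R <= lamR G.
  rewrite -(ler_sqr _ (lamR_ge0 G)) ?nnegrE //; apply: le_trans geG.
  have nQ : Q%:R ^+ 2 + t%:R <= n%:R :> algR.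
    by rewrite -natrX -natrD ler_nat.
  have q0 : 0 <= Q%:R ^+ 2 :> algR by rewrite exprn_ge0.
  by nra.
have [||||||T [cT xT cB xnT]] := @high_degree_vertices _ G r t C x (lamR G)
    C0 t0 sparse few x0 x1 eigen (lamR_ge0 G) eps K M n0 eps0 _ _ _ _ _ _ u xu.
- by lra.
- have -> : 64 * C%:R ^+ 3 = eps ^+ 2 * Q%:R.
    by rewrite /Q /eps natrM (natrM _ 64) !natrX; field; rewrite gt_eqF.
  by rewrite ler_wpM2l // exprn_ge0 // ltW.
- by rewrite /K natrM (natrM _ 4) natrX [leRHS]mulrC -[leRHS]mulrA mulfV ?mulr1 // gt_eqF.
- by [].
- by rewrite mulrC ler_pdivlMr // -natrM ler_nat mulnC.
- by [].
have nR : 0 < n%:R :> algR by rewrite ltr0n.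
have B_big : (r <= #|common T|)%N.
  rewrite -(ler_nat algR).
  have : 4 * C%:R * eps * t%:R * n%:R <= 1 / 8 * n%:R by rewrite ler_wpM2r // ltW.
  have : (2 * r)%:R <= n%:R :> algR by rewrite ler_nat.
  by rewrite natrM; move: cB; rewrite -/n; lra.
have [g [g_bij F_dom F_common]] := emb T cT B_big.
apply: (@spectral_compare G F r C x T (8 * C%:R * t.+1%:R * eps) g) => //.
- move=> v vT; apply: ltnW; rewrite -common_setU1.
  by apply: few; rewrite cardsU1 vT cT.
- by move=> v /xT; lra.
- by rewrite mulrC eq_e.
- by rewrite -card_gt0 cT.
Qed.

Local Close Scope ring_scope.

(** * Invariance under isomorphism and the two cases of the theorem *)

Lemma isomorphic_lamR_le (G H : sgraph) : (0 < #|G|)%N ->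
  isomorphic G H -> (lamR G <= lamR H)%R.
Proof.
move=> G0 [f [[g fK gK] fa]].
have [x [x0 x1 [u xu] eig]] := perron G0.
have fb : bijective f by exists g.
have [le _] := rayleigh (x \o g).
have nE : (\sum_v (x \o g) v ^+ 2 = \sum_v x v ^+ 2)%R.
  by rewrite (reindex _ (onW_bij _ fb)) /=; apply: eq_bigr => v _; rewrite /= fK.
have qE : (\sum_v (\sum_(w | adj H v w) (x \o g) w) * (x \o g) v =
          lamR G * \sum_v x v ^+ 2)%R.
  rewrite (reindex _ (onW_bij _ fb)) mulr_sumr /=; apply: eq_bigr => v _.
  rewrite /= fK expr2 mulrA -eig; congr (_ * _)%R.
  rewrite (reindex _ (onW_bij _ fb)) /=; apply: eq_big => w; first by rewrite fa.
  by rewrite fK.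
rewrite qE nE ler_pM2r // in le.
rewrite (bigD1 u) //= xu expr1n ltr_wpDr ?ltr01 //.
by apply: sumr_ge0 => v _; apply: exprn_ge0.
Qed.

Lemma isomorphic_sym (G H : sgraph) : isomorphic G H -> isomorphic H G.
Proof.
case=> f [[g fK gK] fa]; exists g; split; first by exists f.
by move=> x y; rewrite -fa !gK.
Qed.

Lemma isomorphic_lambda (G H : sgraph) : (0 < #|G|)%N ->
  isomorphic G H -> lambda G = lambda H.
Proof.
move=> G0 iso; apply/lamR_eq/le_anti; rewrite isomorphic_lamR_le //=.
apply: isomorphic_lamR_le; last exact: isomorphic_sym.
by case: iso => f [fb _]; rewrite -(bij_eq_card fb).
Qed.

Lemma edges_completeP r (A : {set 'I_r}) :
  A \in edges (complete r) -> exists a b, a != b /\ A = [set a; b].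
Proof. by case/imsetP => -[a b]; rewrite inE => ab ->; exists a, b. Qed.

Lemma card_gt2_third (V : finType) (A : {set V}) (a b : V) :
  (2 < #|A|)%N -> exists2 c, c \in A & (c != a) && (c != b).
Proof.
move=> lt; have : (0 < #|A :\: [set a; b]|)%N.
  rewrite cardsD subn_gt0; apply: leq_ltn_trans lt.
  apply: leq_trans (subset_leq_card (subsetIr _ _)) _.
  by rewrite cards2; case: (a != b).
by case/card_gt0P => c; rewrite !inE negb_or => /andP[? ?]; exists c.
Qed.

Lemma not_matching_path r (M : {set {set 'I_r}}) : M \subset edges (complete r) ->
  ~ matching M -> exists p q s, [/\ uniq [:: p; q; s],
    [set p; q] \in M & [set q; s] \in M].
Proof.
move=> /subsetP ME nM.
suff : ~~ [forall A in M, forall B in M, (A != B) ==> [disjoint A & B]].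
  move=> /forall_inPn [A AM /forall_inPn [B BM]]; rewrite negb_imply => /andP[AB].
  rewrite -setI_eq0 => /set0Pn [q]; rewrite inE => /andP[qA qB].
  have other D : D \in M -> q \in D -> exists2 p, p != q & D = [set p; q].
    move=> /ME /edges_completeP [a [b [ab ->]]]; rewrite !inE => /orP[]/eqP->.
      by exists b; rewrite 1?eq_sym // setUC.
    by exists a.
  have [p pq EA] := other A AM qA; have [s sq EB] := other B BM qB.
  exists p, q, s; rewrite -EA [in [set q; s]]setUC -EB; split=> //.
  rewrite /= !inE negb_or pq (eq_sym q) sq !andbT /=.
  by apply: contraNneq AB => ps; rewrite EA EB ps.
apply/negP => /forall_inP h; apply: nM; apply/trivIsetP => A B AM BM AB.
by have /forall_inP /(_ B BM) /implyP := h A AM; apply.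
Qed.

Section Extremal.
Variables (r : nat) (M : {set {set 'I_r}}).
Hypotheses (r4 : (4 <= r)%N) (ME : M \subset edges (complete r)) (M0 : M != set0).
Local Notation H := (@del_edges (complete r) M).

(** The common part of both cases: any single edge of [M] gives the bound on common neighbours, and
    only the embedding depends on the case. *)
Lemma extremal_join (K : nat -> sgraph) :
  (forall n, r <= n -> #|gjoin (complete (r - 3)) (K n)| = n)%N ->
  (forall n (G : sgraph) (T : {set G}), #|G| = n -> minor_free H G ->
     #|T| = (r - 3)%N -> (r <= #|common T|)%N ->
     exists g : gjoin (complete (r - 3)) (K n) -> G, [/\ bijective g,
        forall a b, g a \in T -> b != a -> adj (gjoin (complete (r - 3)) (K n)) a b &
        forall a b, g a \in common T -> g b \in common T ->
          adj G (g a) (g b) -> adj (gjoin (complete (r - 3)) (K n)) a b]) ->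
  exists N : nat, forall (n : nat) (G : sgraph),
     (N <= n)%N -> #|G| = n -> minor_free H G ->
     (lambda G <= lambda (gjoin (complete (r - 3)) (K n)))%R /\
     (lambda G = lambda (gjoin (complete (r - 3)) (K n)) <->
      isomorphic G (gjoin (complete (r - 3)) (K n))).
Proof.
move=> cK emb.
have t0 : (0 < r - 3)%N by rewrite subn_gt0.
have C0 : (0 < 2 ^ r.-1)%N by rewrite expn_gt0.
have [n0 ext] := extremal_compare r t0 C0.
have [A AM] := set0Pn _ M0.
have [a [b [ab EA]]] := edges_completeP (subsetP ME _ AM).
exists (maxn n0 r) => n G; rewrite geq_max => /andP[nn0 rn] cG Gfree.
have [||||||le eq] := ext G (gjoin (complete (r - 3)) (K n)).
- by rewrite cG.
- by rewrite cK.
- exact: free_sparse Gfree.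
- by move=> T; apply: (free_few_common r4 Gfree ab); rewrite -EA.
- exact: join_dominating.
- by move=> T; apply: emb.
rewrite -lamR_le; split=> //; split=> [/lamR_eq//|].
by apply: isomorphic_lambda; rewrite cG; apply: leq_trans rn; apply: leq_trans r4.
Qed.

End Extremal.

Theorem theorem5p1 (r : nat) (M : {set {set 'I_r}})
    (hr : (4 <= r)%N) (hM : M \subset edges (complete r)) (hM0 : M != set0) :
  (matching M ->
   exists N : nat, forall (n : nat) (G : sgraph),
     (N <= n)%N -> #|G| = n ->
     minor_free (@del_edges (complete r) M) G ->
     (lambda G <= lambda (F_graph n (r - 3)))%R /\
     (lambda G = lambda (F_graph n (r - 3)) <->
      isomorphic G (F_graph n (r - 3)))) /\
  (~ matching M -> gconnected (edge_graph M) -> triangle_free (edge_graph M) ->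
   exists N : nat, forall (n : nat) (G : sgraph),
     (N <= n)%N -> #|G| = n ->
     minor_free (@del_edges (complete r) M) G ->
     (lambda G <= lambda (S_graph n (r - 3)))%R /\
     (lambda G = lambda (S_graph n (r - 3)) <->
      isomorphic G (S_graph n (r - 3)))).
Proof.
have t0 : (0 < r - 3)%N by rewrite subn_gt0.
have tn n : (r <= n)%N -> (r - 3 <= n)%N by apply: leq_trans (leq_subr _ _).
split=> [_|nM _ _].
  apply: (extremal_join hr hM hM0) => [n /tn|n G T cG Gfree cT cB].
    exact: card_F_graph.
  have [A AM] := set0Pn _ hM0.
  have [a [b [ab EA]]] := edges_completeP (subsetP hM _ AM).
  have [c _ /andP[ca cb]] : exists2 c, c \in [set: 'I_r] & (c != a) && (c != b).
    by apply: card_gt2_third; rewrite cardsT card_ord; apply: leq_trans hr.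
  apply: F_embedding => // x y z xB yB zB xy xz.
  apply/eqP; apply: contraT => yz.
  have xyn : x != y by apply: contraTneq xy => ->; rewrite adj_irr.
  have xzn : x != z by apply: contraTneq xz => ->; rewrite adj_irr.
  (* Two neighbours [y], [z] of [x] in [common T] give a path [y x z] in the roles [a], [c], [b];
     the pair [y z] is covered by the deleted edge [ab]. *)
  case: (@free_join r M G hr Gfree a c b y x z T) => //.
  - by rewrite /= !inE negb_or ab cb eq_sym ca.
  - by rewrite /= !inE negb_or yz xzn eq_sym xyn.
  - by rewrite adj_sym xy.
  - by rewrite xz.
  by rewrite -EA AM orbT.
apply: (extremal_join hr hM hM0) => [n /tn|n G T cG Gfree cT cB].
  exact: card_S_graph.
have [p [q [s [pqs pqM qsM]]]] := not_matching_path hM nM.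
apply: S_embedding => // x y xB yB; apply/negP => xy.
have [z zB /andP[zx zy]] : exists2 z, z \in common T & (z != x) && (z != y).
  by apply: card_gt2_third; apply: leq_trans cB; apply: leq_trans hr.
have xyn : x != y by apply: contraTneq xy => ->; rewrite adj_irr.
(* The edge [x y] plays [p s], and any third common neighbour [z] plays [q], whose edges to [p] and
   [s] are deleted. *)
apply: (@free_join r M G hr Gfree p q s x z y T) => //.
- by rewrite /= !inE negb_or xyn zy eq_sym zx.
- by rewrite pqM orbT.
- by rewrite qsM orbT.
by rewrite xy.
Qed.
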